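(* Let $q$ be an odd prime power. Let $f \in \mathbb{F}_q[Y_0, Y_1]_{q+1}$ be a homogeneous polynomial of degree $q+1$ such that $V(f) \subset \mathbb{P}^1$ has no $\mathbb{F}_q$-rational point. Then there exists a homogeneous polynomial $g \in \mathbb{F}_q[X_0, X_1]_{q+1}$ of degree $q+1$ such that the subscheme $C_{f,g} \subset (\mathbb{P}^1 \times \mathbb{P}^1)_{\mathbb{F}_q}$ is a smooth space filling curve.
   Context: $\mathbb{F}_q$ is the finite field with $q$ elements and $\overline{\mathbb{F}}_q$ its algebraic closure. $\mathbb{F}_q[Z_0,Z_1]_d$ denotes the $\mathbb{F}_q$-space of homogeneous polynomials of degree $d$. $V(\cdot)$ denotes the zero locus of a (bi)homogeneous polynomial. Thus $V(f)$ having no $\mathbb{F}_q$-rational point means $f(y_0,y_1)\neq 0$ for all $(y_0,y_1)\in\mathbb{F}_q^2\setminus\{(0,0)\}$. For $f \in \mathbb{F}_q[Y_0,Y_1]_{q+1}$ and $g\in\mathbb{F}_q[X_0,X_1]_{q+1}$, let $$F = f(Y_0,Y_1)(X_0^qX_1 - X_0X_1^q) + g(X_0,X_1)(Y_0^qY_1 - Y_0Y_1^q),$$ which is bihomogeneous of bidegree $(q+1,q+1)$ in $(X_0,X_1;Y_0,Y_1)$, and let $C_{f,g} = V(F) \subset (\mathbb{P}^1\times\mathbb{P}^1)_{\mathbb{F}_q}$, where $X_0,X_1$ (resp. $Y_0,Y_1$) are the homogeneous coordinates on the first (resp. second) factor. A subscheme $C\subset \mathbb{P}^1\times\mathbb{P}^1$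 over $\mathbb{F}_q$ is a space filling curve if $\dim C = 1$ and $C(\mathbb{F}_q) = (\mathbb{P}^1\times\mathbb{P}^1)(\mathbb{F}_q)$. The curve $C=V(F)$ is smooth if and only if there is no point $P\in C(\overline{\mathbb{F}}_q)$ with $F(P)=F_{X_0}(P)=F_{X_1}(P)=F_{Y_0}(P)=F_{Y_1}(P)=0$, where subscripts denote formal partial derivatives. *)

(* Defs.v *)
From HB Require Import structures.
From mathcomp Require Import all_boot all_order all_algebra all_field.
From mathcomp Require Export mpoly.

Set Implicit Arguments.
Unset Strict Implicit.
Unset Printing Implicit Defensive.

Import GRing.Theory.
Local Open Scope ring_scope.

(* The coordinate ring of P^1 x P^1 is R[X_0, X_1, Y_0, Y_1]; the variables are
   indexed by 'I_(2 + 2), the left summand for X and the right one for Y. *)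
Definition varX (R : nzRingType) (i : 'I_2) : {mpoly R[2 + 2]} :=
  'X_(lshift 2 i).
Definition varY (R : nzRingType) (j : 'I_2) : {mpoly R[2 + 2]} :=
  'X_(rshift 2 j).

Definition inX (R : comNzRingType) (g : {mpoly R[2]}) : {mpoly R[2 + 2]} :=
  g \mPo [tuple varX R i | i < 2].
Definition inY (R : comNzRingType) (f : {mpoly R[2]}) : {mpoly R[2 + 2]} :=
  f \mPo [tuple varY R j | j < 2].

Definition curve_eq (R : comNzRingType) (q : nat) (f g : {mpoly R[2]}) :
    {mpoly R[2 + 2]} :=
  let X := varX R in let Y := varY R in
    inY f * (X 0 ^+ q * X 1 - X 0 * X 1 ^+ q)
  + inX g * (Y 0 ^+ q * Y 1 - Y 0 * Y 1 ^+ q).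

(* Points of P^1 over a field are given by nonzero coordinate vectors; every
   condition below is invariant under rescaling, for forms that are
   (bi)homogeneous. *)
Definition eval2 (K : comNzRingType) (F : {mpoly K[2 + 2]}) (x y : 'rV[K]_2) :
    K := F.@[row_mx x y 0].

Definition no_rational_point (k : fieldType) (f : {mpoly k[2]}) : Prop :=
  forall y : 'rV[k]_2, y != 0 -> f.@[y 0] != 0.

(* C(k) = (P^1 x P^1)(k); the inclusion C(k) \subset (P^1 x P^1)(k) holds by
   definition. *)
Definition all_rational_points (k : fieldType) (F : {mpoly k[2 + 2]}) : Prop :=
  forall x y : 'rV[k]_2, x != 0 -> y != 0 -> eval2 F x y = 0.

(* The Jacobian criterion on the points of V(F) over K; K is meant to be an
   algebraic closure of k. *)
Definition smooth_over (k K : fieldType) (iota : {rmorphism k -> K})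
    (F : {mpoly k[2 + 2]}) : Prop :=
  let FK := map_mpoly iota F in
  ~ exists x y : 'rV[K]_2,
      [/\ x != 0, y != 0, eval2 FK x y = 0 &
          forall i : 'I_(2 + 2), eval2 (FK^`M(i)) x y = 0].

Definition degX (m : 'X_{1..2 + 2}) : nat := (\sum_(i < 2) m (lshift 2 i))%N.
Definition degY (m : 'X_{1..2 + 2}) : nat := (\sum_(j < 2) m (rshift 2 j))%N.

Fact degX0 : degX 0%MM = 0%N.
Proof. by rewrite /degX big1 // => i _; rewrite mnmE. Qed.

Fact degXD : {morph degX : m n / (m + n)%MM >-> (m + n)%N}.
Proof.
by move=> m n; rewrite /degX -big_split; apply: eq_bigr => i _; rewrite mnmDE.
Qed.

Fact degY0 : degY 0%MM = 0%N.
Proof. by rewrite /degY big1 // => i _; rewrite mnmE. Qed.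

Fact degYD : {morph degY : m n / (m + n)%MM >-> (m + n)%N}.
Proof.
by move=> m n; rewrite /degY -big_split; apply: eq_bigr => i _; rewrite mnmDE.
Qed.

HB.instance Definition _ := isMeasure.Build (2 + 2)%N degX degX0 degXD.
HB.instance Definition _ := isMeasure.Build (2 + 2)%N degY degY0 degYD.

(* [pihomog degX d] and [pihomog degY d] are the projections to the components
   of degree d in X and in Y: an ideal closed under both families is one that
   contains the bihomogeneous components of its elements. *)
Definition bihomogeneous_ideal (k : fieldType) (P : {pred {mpoly k[2 + 2]}}) :
    Prop :=
  idealr_closed P /\
  forall (d : nat) (p : {mpoly k[2 + 2]}), p \in P ->
    (pihomog degX d p \in P) /\ (pihomog degY d p \in P).

(* The points of the closed subscheme V(F) of P^1 x P^1 = biProj k[X, Y]: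
   bihomogeneous prime ideals that contain F but not the irrelevant ideal
   (X_0, X_1)(Y_0, Y_1). *)
Definition scheme_point (k : fieldType) (F : {mpoly k[2 + 2]})
    (P : {pred {mpoly k[2 + 2]}}) : Prop :=
  [/\ bihomogeneous_ideal P, prime_idealr_closed P, F \in P,
      exists i, varX k i \notin P & exists j, varY k j \notin P].

(* Irreducible closed subsets of a scheme are the closures of its points, and
   the closure of P' lies in that of P exactly when P is included in P'. A
   chain of length n of irreducible closed subsets is thus a strictly increasing
   sequence of n + 1 points. *)
Definition scheme_chain (k : fieldType) (F : {mpoly k[2 + 2]}) (n : nat)
    (P : 'I_n.+1 -> {pred {mpoly k[2 + 2]}}) : Prop :=
  (forall i, scheme_point F (P i)) /\
  forall i j : 'I_n.+1, (i < j)%N ->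
    {subset P i <= P j} /\ exists2 p, p \in P j & p \notin P i.

Definition scheme_dim (k : fieldType) (F : {mpoly k[2 + 2]}) (n : nat) : Prop :=
  (exists P : 'I_n.+1 -> {pred {mpoly k[2 + 2]}}, scheme_chain F P) /\
  forall (m : nat) (P : 'I_m.+1 -> {pred {mpoly k[2 + 2]}}),
    scheme_chain F P -> (m <= n)%N.

Definition space_filling_curve (k : fieldType) (F : {mpoly k[2 + 2]}) : Prop :=
  scheme_dim F 1 /\ all_rational_points F.

(* Main.v *)
From HB Require Import structures.
Require Import Defs.
From mathcomp Require Import all_boot all_order all_algebra all_field.
From mathcomp Require Import ring.
From mathcomp Require Import boolp.

(** Let [A (Z_0, Z_1) = Z_0^q Z_1 - Z_0 Z_1^q], so that the curve has equation
    [F = f (Y) A (X) + g (X) A (Y)]. The form [A] vanishes exactly at the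
    rational points, and its gradient is [(- Z_1^q, Z_0^q)]. In particular
    [C] contains all rational points whatever [g] is.

    Smoothness. At a singular point [(x, y)], the point [y] is not rational,
    since otherwise [f (y) != 0] and the derivatives in [X] force [x = 0];
    likewise [x] is not rational if [g] has no rational zero. The singular
    points are then the pairs [(s, t)] such that [t] is a critical point of the
    rational function [f / A], [s] is a critical point of [g / A], and the two
    critical values are opposite ([smooth_criterion]). So [g] must be chosen to
    make the critical values of [- g / A] avoid those of [f / A], which are
    at most [2 q] in number and form a set stable under Frobenius
    ([size_critical_values], [critical_value_frobenius]). For [mu] in [F_{q^2}]
    but not in [F_q], with trace [T] and norm [N], the form
    [g = X_0^{q+1} - T X_0^q X_1 + N X_1^{q+1}] has no rational zero, and the
    only critical values of [- g / A] are [mu] and [mu^q]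
    ([root_crit_quadratic]). This [g] is good unless [mu] is a critical value of
    [f / A]. If that happens for all [q^2 - q] choices of [mu], then [q = 3] and
    these are all the critical values of [f / A]; in that case
    [g = (X_0^2 + X_1^2)^2] is good, as its critical values lie in [F_3]
    ([smooth_member]).

    Dimension at most 1. A chain of three points lies in a product of two
    standard affine charts, hence gives a strict chain of three nonzero primes
    of [k[x, y]]. But a prime that strictly contains a nonzero prime contains a
    nonzero polynomial in [x] and one in [y], by resultants, and is therefore
    maximal, its residue ring being a finite domain ([affine_plane_no_chain],
    [scheme_chain_bound]).

    Dimension at least 1. The curve is smooth at the rational point
    [((1 : 0), (1 : 0))], because [f (1, 0) != 0], so it has there a formal
    branch, given by Newton iteration. The forms that vanish on the branch and
    those that vanish at its origin are two distinct nested points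
    ([scheme_chain_length1]). *)

Set Implicit Arguments.
Unset Strict Implicit.
Unset Printing Implicit Defensive.

Import GRing.Theory.
Local Open Scope ring_scope.

(** * Substitution in multivariate polynomials *)

(** Polynomials are generated by constants and variables: this turns every
    compatibility below between two ring operations into a check on
    generators. *)
Lemma mpoly_ring_ind (n : nat) (R : nzRingType) (P : {mpoly R[n]} -> Prop) :
    (forall c, P c%:MP) -> (forall i, P 'X_i) ->
    (forall p r, P p -> P r -> P (p + r)) ->
    (forall p r, P p -> P r -> P (p * r)) -> forall p, P p.
Proof.
move=> PC PX PD PM; elim/mpolyind => [|c m p _ _ Pp]; first exact: (PC 0).
apply: PD Pp; rewrite -mul_mpolyC; apply: (PM) => //.
rewrite mpolyXE_id; elim/big_ind: _ => [|x y|i _];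
  [exact: (PC 1) | exact: PM |].
elim: (m i) => [|e IH]; first exact: (PC 1).
by rewrite exprS; apply: PM.
Qed.

Lemma eq_mmap (n : nat) (R S : nzRingType) (h : R -> S) (v w : 'I_n -> S)
  (p : {mpoly R[n]}) : v =1 w -> mmap h v p = mmap h w p.
Proof.
move=> vw; apply: eq_bigr => m _; congr (_ * _).
by apply: eq_bigr => i _; rewrite vw.
Qed.

Lemma rmorph_mmap (n : nat) (R S T : nzRingType) (phi : {rmorphism S -> T})
    (h : R -> S) (v : 'I_n -> S) (p : {mpoly R[n]}) :
  phi (mmap h v p) = mmap (phi \o h) (phi \o v) p.
Proof.
rewrite rmorph_sum; apply: eq_bigr => m _; rewrite rmorphM rmorph_prod.
by congr (_ * _); apply: eq_bigr => i _; rewrite rmorphXn.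
Qed.

Lemma mmap_scale_homog (n d : nat) (R : nzRingType) (S : comNzRingType)
    (h : R -> S)
    (c : S) (v : 'I_n -> S) (p : {mpoly R[n]}) :
  p \is d.-homog -> mmap h (fun i => c * v i) p = c ^+ d * mmap h v p.
Proof.
move=> /dhomogP p_d; rewrite mulr_sumr; apply: eq_big_seq => m /p_d <-;
  rewrite mulrCA; congr (_ * _).
rewrite /= mdegE -prodrXr -big_split; apply: eq_bigr => i _.
by rewrite exprMn.
Qed.

(** The chain rule. It trades formal partial derivatives of the equation of the
    curve for derivatives of univariate restrictions, which are easy to
    compute. *)
Lemma deriv_mmap (n : nat) (R : nzRingType) (S : comNzRingType)
    (h : {rmorphism R -> S}) (w : 'I_n -> {poly S}) (p : {mpoly R[n]}) :
  (mmap (polyC \o h) w p)^`()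
  = \sum_i (w i)^`() * mmap (polyC \o h) w (p^`M(i)).
Proof.
elim/mpoly_ring_ind: p => [c|i|p r IHp IHr|p r IHp IHr].
- rewrite mmapC /= derivC big1 // => i _.
  by rewrite mderivC mmap0 mulr0.
- rewrite (bigD1 i) //= big1 => [|j ji]; rewrite mderivX mnm1E.
    rewrite eqxx scale1r -{1 2}(add0m U_(i)%MM) addmK mpolyX0 rmorph1 mulr1
      addr0.
    by rewrite add0m mmapX mmap1U.
  by rewrite eq_sym (negPf ji) scale0r mmap0 mulr0.
- rewrite mmapD derivD IHp IHr -big_split; apply: eq_bigr => i _ /=.
  by rewrite mderivD mmapD mulrDr.
- rewrite rmorphM derivM IHp IHr mulr_suml mulr_sumr -big_split.
  apply: eq_bigr => i _ /=; rewrite mderivM rmorphD !rmorphM /= mulrDr.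
  by rewrite -[X in X + _]mulrA [X in _ + X]mulrCA.
Qed.

Lemma ord2P (j : 'I_2) : j = 0 \/ j = 1.
Proof. by case: j => [[|[|//]] ij]; [left | right]; apply: val_inj. Qed.

Lemma row2_neq0 (R : nmodType) (z : 'rV[R]_2) :
  z != 0 -> (z 0 0 != 0) || (z 0 1 != 0).
Proof.
apply: contra_neqT; rewrite negb_or !negbK => /andP[/eqP z0 /eqP z1].
by apply/rowP => j; rewrite mxE; have [->|->] := ord2P j.
Qed.

Definition pair2 (T : Type) (a b : T) (j : 'I_2) : T := if j == 0 then a else b.

(** A binary form is evaluated at a pair, through an arbitrary coefficient map:
    the same form is used over the base field, over its closure, over polynomial
    rings and along formal branches. *)
Definition form2 (R S : nzRingType) (h : R -> S) (f : {mpoly R[2]}) (a b : S) :=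
  mmap h (pair2 a b) f.

Lemma form2_scale (d : nat) (R : nzRingType) (S : comNzRingType) (h : R -> S)
    (f : {mpoly R[2]}) (c a b : S) :
  f \is d.-homog -> form2 h f (c * a) (c * b) = c ^+ d * form2 h f a b.
Proof.
move=> f_d; rewrite -(mmap_scale_homog _ _ _ f_d); apply: eq_mmap => j.
by rewrite /pair2; case: ifP.
Qed.

Lemma rmorph_form2 (R S T : nzRingType) (phi : {rmorphism S -> T}) (h : R -> S)
    (f : {mpoly R[2]}) (a b : S) :
  phi (form2 h f a b) = form2 (phi \o h) f (phi a) (phi b).
Proof. by rewrite rmorph_mmap; apply: eq_mmap => j /=; rewrite /pair2;
  case: ifP. Qed.

Lemma mmap_inX (R S : comNzRingType) (h : {rmorphism R -> S})
    (v : 'I_(2 + 2) -> S) (g : {mpoly R[2]}) :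
  mmap h v (inX g) = form2 h g (v (lshift 2 0)) (v (lshift 2 1)).
Proof.
rewrite [LHS]rmorph_mmap; apply: eq_bigr => m _; rewrite /= mmapC.
congr (_ * _); apply: eq_bigr => j _; congr (_ ^+ _).
rewrite /= tnth_mktuple /varX mmapX mmap1U /pair2.
by case: j => [[|[|//]] ?] /=; congr v; apply: val_inj.
Qed.

Lemma mmap_inY (R S : comNzRingType) (h : {rmorphism R -> S})
    (v : 'I_(2 + 2) -> S) (f : {mpoly R[2]}) :
  mmap h v (inY f) = form2 h f (v (rshift 2 0)) (v (rshift 2 1)).
Proof.
rewrite [LHS]rmorph_mmap; apply: eq_bigr => m _; rewrite /= mmapC.
congr (_ * _); apply: eq_bigr => j _; congr (_ ^+ _).
rewrite /= tnth_mktuple /varY mmapX mmap1U /pair2.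
by case: j => [[|[|//]] ?] /=; congr v; apply: val_inj.
Qed.

Lemma mmap_curve_eq (q : nat) (R S : comNzRingType) (h : {rmorphism R -> S})
    (v : 'I_(2 + 2) -> S) (f g : {mpoly R[2]}) :
  let x0 := v (lshift 2 0) in let x1 := v (lshift 2 1) in
  let y0 := v (rshift 2 0) in let y1 := v (rshift 2 1) in
  mmap h v (curve_eq q f g) =
    form2 h f y0 y1 * (x0 ^+ q * x1 - x0 * x1 ^+ q)
  + form2 h g x0 x1 * (y0 ^+ q * y1 - y0 * y1 ^+ q).
Proof.
pose phi : {rmorphism {mpoly R[2 + 2]} -> S} := mmap h v.
have phiE p : mmap h v p = phi p by [].
have phiX i : phi 'X_i = v i by rewrite -phiE mmapX mmap1U.
rewrite /= -mmap_inX -mmap_inY !phiE /curve_eq /varX /varY -!phiX.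
by rewrite -!(rmorphXn phi) -!(rmorphM phi) -!(rmorphB phi) -!(rmorphM phi)
  -(rmorphD phi).
Qed.

Lemma meval_map_mpoly (n : nat) (R S : comNzRingType) (h : {rmorphism R -> S})
    (v : 'I_n -> S) (p : {mpoly R[n]}) :
  (map_mpoly h p).@[v] = mmap h v p.
Proof.
rewrite /map_mpoly (rmorph_mmap (meval v)); apply: eq_bigr => m _.
rewrite /= mevalC; congr (_ * _); apply: eq_bigr => i _.
by rewrite /= mevalXU.
Qed.

Lemma mderiv_map_mpoly (n : nat) (R S : comNzRingType) (h : {rmorphism R -> S})
    (i : 'I_n) (p : {mpoly R[n]}) :
  (map_mpoly h p)^`M(i) = map_mpoly h (p^`M(i)).
Proof.
by apply/mpolyP => m;
  rewrite mcoeff_map_mpoly !mcoeff_deriv mcoeff_map_mpoly /= raddfMn.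
Qed.

(** * The Jacobian criterion for the curve *)

(** The form of the condition that makes [x |-> x ^+ #|k|] additive on [S]. *)
Lemma pnat_pchar_card (k : finFieldType) (S : nzRingType)
    (h : {rmorphism k -> S}) :
  [pchar S].-nat #|k|.
Proof.
have [p _ p_char] := finPcharP k.
rewrite (card_pprimeChar p_char).
have/pcharf_eq pS := rmorph_pchar h p_char.
by rewrite (eq_pnat _ pS) pnatX pnat_id ?(pcharf_prime p_char).
Qed.

Lemma fixed_frobenius (k : finFieldType) (K : fieldType)
    (h : {rmorphism k -> K}) (x : K) :
  x ^+ #|k| = x -> exists c, x = h c.
Proof.
move=> xq; have /(congr1 (map_poly h)) := finField_genPoly k.
rewrite rmorphB rmorph_prod /= map_polyXn map_polyX => /(congr1 (horner^~ x)).
rewrite hornerD hornerN hornerXn hornerX xq subrr horner_prod => /esym/eqP.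
case/prodf_eq0 => c _; rewrite rmorphB /= map_polyX map_polyC /= hornerXsubC.
by rewrite subr_eq0 => /eqP; exists c.
Qed.

(** The partial derivative at [v] along the [i]th variable is the derivative of
    the restriction to the line through [v] in that direction. *)
Lemma deriv_mmap_at (n : nat) (R S : comNzRingType) (h : {rmorphism R -> S})
    (v : 'I_n -> S) (i : 'I_n) (p : {mpoly R[n]}) :
  (mmap (polyC \o h) (fun j => if j == i then 'X else (v j)%:P) p)^`().[v i]
  = mmap h v (p^`M(i)).
Proof.
rewrite deriv_mmap (bigD1 i) //= big1 => [|j /negPf ji]; last first.
  by rewrite ji derivC mul0r.
rewrite eqxx derivX mul1r addr0 -[_.[_]]/(horner_eval (v i) _) rmorph_mmap.
rewrite /mmap; apply: eq_bigr => m _; rewrite /= /horner_eval hornerC.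
congr (_ * _); apply: eq_bigr => j _; congr (_ ^+ _) => /=.
by case: eqP => [->|_]; rewrite ?hornerX ?hornerC.
Qed.

Lemma natr_card (k : finFieldType) (S : nzRingType) (h : {rmorphism k -> S}) :
  #|k|%:R = 0 :> S.
Proof.
have [p p_pr p_char] := finPcharP k.
have k_gt1 := finNzRing_gt1 k.
rewrite -(rmorph_nat h) -[RHS](rmorph0 h); congr (h _); apply/eqP.
rewrite -(dvdn_pcharf p_char).
move: k_gt1; rewrite (card_pprimeChar p_char).
by case: (logn _ _) => [|e] // _; rewrite expnS dvdn_mulr.
Qed.

(** The form restricted to the affine line [(t : 1)]. *)
Definition dehom (R S : nzRingType) (h : R -> S) (f : {mpoly R[2]}) :
    {poly S} :=
  form2 (polyC \o h) f 'X 1.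

Section Singular.
Variables (k : finFieldType) (K : fieldType) (h : {rmorphism k -> K}).
Let q := #|k|.

Lemma form2_polyC (f : {mpoly k[2]}) (a b : K) :
  form2 (polyC \o h) f a%:P b%:P = (form2 h f a b)%:P.
Proof. by rewrite rmorph_form2. Qed.

(** Since [q] vanishes in [K], the gradient of [Z_0^q Z_1 - Z_0 Z_1^q] is [(-
    Z_1^q, Z_0^q)]; only [f] and [g] contribute genuine derivatives. *)
Lemma partial_curve_eq (f g : {mpoly k[2]}) (v : 'I_(2 + 2) -> K) :
  let x0 := v (lshift 2 0) in let x1 := v (lshift 2 1) in
  let y0 := v (rshift 2 0) in let y1 := v (rshift 2 1) in
  let Ax := x0 ^+ q * x1 - x0 * x1 ^+ q in
  let Ay := y0 ^+ q * y1 - y0 * y1 ^+ q in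
  let d i := mmap h v ((curve_eq q f g)^`M(i)) in
  [/\ d (lshift 2 0) = (form2 (polyC \o h) g 'X x1%:P)^`().[x0] * Ay
                       - form2 h f y0 y1 * x1 ^+ q,
      d (lshift 2 1) = (form2 (polyC \o h) g x0%:P 'X)^`().[x1] * Ay
                       + form2 h f y0 y1 * x0 ^+ q,
      d (rshift 2 0) = (form2 (polyC \o h) f 'X y1%:P)^`().[y0] * Ax
                       - form2 h g x0 x1 * y1 ^+ q
    & d (rshift 2 1) = (form2 (polyC \o h) f y0%:P 'X)^`().[y1] * Ax
                       + form2 h g x0 x1 * y0 ^+ q].
Proof.
move=> x0 x1 y0 y1 Ax Ay d.
have q0 : q%:R = 0 :> {poly K} by apply: (natr_card (polyC \o h)).
have derXq : ('X^q)^`() = 0 :> {poly K} by rewrite derivXn -mulr_natl q0 mul0r.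
split; rewrite /d -deriv_mmap_at mmap_curve_eq /= -!polyC_exp !form2_polyC
  -!polyCM -!polyCB
  -?/x0 -?/x1 -?/y0 -?/y1;
  rewrite derivD !derivM !derivB !derivM !derivC derXq derivX;
  rewrite !hornerE /= /Ax /Ay; ring.
Qed.

Lemma no_rational_zero (f : {mpoly k[2]}) (a b : k) :
  no_rational_point f -> (a != 0) || (b != 0) -> form2 h f (h a) (h b) != 0.
Proof.
move=> f0 ab; have -> : form2 h f (h a) (h b) = h (form2 idfun f a b).
  by rewrite rmorph_form2.
rewrite fmorph_eq0.
have := f0 (\row_j pair2 a b j); rewrite /meval.
rewrite (eq_mmap _ (w := pair2 a b)) => [|j]; last by rewrite mxE.
apply; apply: contraTneq ab => /rowP ab.
by have := ab 0; have := ab 1; rewrite !mxE /pair2 /= => -> ->; rewrite eqxx.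
Qed.

(** The form [Z_0^q Z_1 - Z_0 Z_1^q] is the product of the linear forms over
    [k], so a point where it vanishes is a multiple of a rational point. *)
Lemma rational_or_nonzero (f : {mpoly k[2]}) (y0 y1 : K) :
    f \is q.+1.-homog -> no_rational_point f -> (y0 != 0) || (y1 != 0) ->
    y0 ^+ q * y1 - y0 * y1 ^+ q = 0 ->
  form2 h f y0 y1 != 0.
Proof.
move=> f_d f0 y_neq0 Ay.
have [y1_0|y1_neq0] := eqVneq y1 0.
  rewrite y1_0 eqxx orbF in y_neq0.
  rewrite y1_0; have -> : form2 h f y0 0 = y0 ^+ q.+1 * form2 h f (h 1) (h 0).
    by rewrite -(form2_scale _ _ _ _ f_d) rmorph1 rmorph0 mulr1 mulr0.
  by rewrite mulf_neq0 ?expf_neq0 ?no_rational_zero ?oner_eq0.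
have [c yc] : exists c, y0 / y1 = h c.
  apply: (fixed_frobenius (k := k)).
  rewrite expr_div_n -/q; apply/eqP; rewrite eqr_div ?expf_neq0 //.
  by rewrite -subr_eq0 Ay.
have -> : form2 h f y0 y1 = y1 ^+ q.+1 * form2 h f (h c) (h 1).
  by rewrite -(form2_scale _ _ _ _ f_d) rmorph1 mulr1 -yc mulrC divfK.
by rewrite mulf_neq0 ?expf_neq0 ?no_rational_zero ?oner_eq0 ?orbT.
Qed.

End Singular.

(** The elimination behind the Jacobian criterion, with [X], [Y] standing for
    [x1 ^+ q], [y1 ^+ q], with [P], [P'], [R], [R'] for the values and the
    derivatives of the two dehomogenized forms, and with [b], [a] for [t ^+ q -
    t] and [s ^+ q - s]. *)
Lemma critical_pair (K : fieldType) (X x1 Y y1 a b P P' R R' : K) :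
    X != 0 -> x1 != 0 -> Y != 0 -> y1 != 0 -> a != 0 -> b != 0 ->
    Y * y1 * P * (X * x1 * a) + X * x1 * R * (Y * y1 * b) = 0 ->
    X * R' * (Y * y1 * b) - Y * y1 * P * X = 0 ->
    Y * P' * (X * x1 * a) - X * x1 * R * Y = 0 ->
  [/\ P + P' * b = 0, R + R' * a = 0 & R' = - P'].
Proof.
move=> X0 x0 Y0 y0 a0 b0 F0 dX0 dY0.
have PE : P = R' * b.
  apply: (mulfI (x := X * Y * y1)); first by rewrite !mulf_neq0.
  by apply/eqP; rewrite eq_sym -subr_eq0 -dX0; apply/eqP; ring.
have RE : R = P' * a.
  apply: (mulfI (x := X * x1 * Y)); first by rewrite !mulf_neq0.
  by apply/eqP; rewrite eq_sym -subr_eq0 -dY0; apply/eqP; ring.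
have R'P' : R' = - P'.
  apply: (mulfI (x := X * x1 * Y * y1 * a * b)); first by rewrite !mulf_neq0.
  by apply/eqP; rewrite -subr_eq0 -F0 PE RE; apply/eqP; ring.
by rewrite PE RE R'P'; split; ring.
Qed.

Lemma frobenius_form_scale (K : fieldType) (q : nat) (s x : K) :
  (s * x) ^+ q * x - s * x * x ^+ q = x ^+ q * x * (s ^+ q - s).
Proof. rewrite exprMn; ring. Qed.

Section Criterion.
Variables (k : finFieldType) (K : fieldType) (h : {rmorphism k -> K}).
Let q := #|k|.

Lemma horner_dehom (f : {mpoly k[2]}) (t : K) : (dehom h f).[t] = form2 h f t 1.
Proof.
rewrite -[LHS]/(horner_eval t _) [LHS](rmorph_form2 (horner_eval t)).
rewrite /form2 /mmap; apply: eq_bigr => m _; rewrite /= /horner_eval hornerC.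
congr (_ * _); apply: eq_bigr => j _; congr (_ ^+ _).
by rewrite /pair2; case: ifP; rewrite ?hornerX ?hornerC.
Qed.

Lemma form2_dehom (f : {mpoly k[2]}) (a b : K) : f \is q.+1.-homog -> b != 0 ->
  form2 h f a b = b ^+ q.+1 * (dehom h f).[a / b].
Proof.
move=> f_d b0; rewrite horner_dehom -(form2_scale _ _ _ _ f_d) mulr1.
by rewrite mulrC divfK.
Qed.

Lemma deriv_form2_dehom (f : {mpoly k[2]}) (a b : K) : f \is q.+1.-homog ->
    b != 0 ->
  (form2 (polyC \o h) f 'X b%:P)^`().[a] = b ^+ q * (dehom h f)^`().[a / b].
Proof.
move=> f_d b0.
have -> : form2 (polyC \o h) f 'X b%:P
        = b%:P ^+ q.+1 * (dehom h f \Po (b^-1 *: 'X)).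
  rewrite -[_ \Po _]/(comp_poly _ _)
    [comp_poly _ _](rmorph_form2 (comp_poly _)).
  have -> : form2 (comp_poly (b^-1 *: 'X) \o (polyC \o h)) f
              (comp_poly (b^-1 *: 'X) 'X) (comp_poly (b^-1 *: 'X) 1)
          = form2 (polyC \o h) f (b^-1 *: 'X) 1.
    rewrite /form2 /mmap; apply: eq_bigr => m _; rewrite /= comp_polyC.
    congr (_ * _); apply: eq_bigr => j _; congr (_ ^+ _).
    by rewrite /pair2; case: ifP => _; rewrite ?comp_polyX // rmorph1.
  rewrite -(form2_scale _ _ _ _ f_d) mulr1; congr (form2 _ _ _ _).
  by rewrite mul_polyC scalerA divff // scale1r.
rewrite -polyC_exp mul_polyC derivZ deriv_comp derivZ derivX !hornerE /=.
rewrite horner_comp hornerZ hornerX mulr1 [b^-1 * a]mulrC exprSr.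
by rewrite [_ * b * _]mulrAC mulfK.
Qed.

(** As ['X^q - 'X] has derivative [-1], this is the numerator of the derivative
    of [p / ('X^q - 'X)], and at a root [t] of it that is not in [k] the value
    of that fraction is [- p^`().[t]]. *)
Definition crit_poly (p : {poly K}) : {poly K} := p + p^`() * ('X^q - 'X).

(** A singular point whose second coordinate is rational would make both
    [X]-derivatives multiples of a nonzero value of [f], hence [x = 0], and
    symmetrically. At the other singular points, the equation and its two first
    derivatives say that [t] is critical for [f / A], that [s] is critical for
    [g / A], and that the two critical values are opposite. *)
Lemma smooth_criterion (f g : {mpoly k[2]}) :
    f \is q.+1.-homog -> g \is q.+1.-homog ->
    no_rational_point f -> no_rational_point g ->
    (forall s t, root (crit_poly (dehom h f)) t ->
      root (crit_poly (dehom h g)) s ->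
       (dehom h g)^`().[s] <> - (dehom h f)^`().[t]) ->
  smooth_over h (curve_eq q f g).
Proof.
move=> f_d g_d f0 g0 fg FK [x [y [x_neq0 y_neq0]]]; rewrite {}/FK.
have {}x_neq0 := row2_neq0 x_neq0; have {}y_neq0 := row2_neq0 y_neq0.
rewrite /eval2 meval_map_mpoly => F0 dF0.
have {}dF0 i : mmap h (row_mx x y 0) ((curve_eq q f g)^`M(i)) = 0.
  by rewrite -meval_map_mpoly -mderiv_map_mpoly dF0.
have := partial_curve_eq h f g (row_mx x y 0).
rewrite /= !dF0; move: F0; rewrite mmap_curve_eq !row_mxEl !row_mxEr.
set x0 : K := x 0 0 in x_neq0 *; set x1 : K := x 0 1 in x_neq0 *.
set y0 : K := y 0 0 in y_neq0 *; set y1 : K := y 0 1 in y_neq0 *; rewrite -/q.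
set Ax := _ - x0 * _; set Ay := _ - y0 * _.
move=> F0 [/esym dX0 /esym dX1 /esym dY0 /esym dY1].
have Ay_neq0 : Ay != 0.
  apply/eqP => Ay0; have fy := rational_or_nonzero h f_d f0 y_neq0 Ay0.
  move: x_neq0; apply/negP; rewrite negb_or !negbK.
  move/eqP: dX0; rewrite Ay0 mulr0 sub0r oppr_eq0 mulf_eq0
    (negPf fy) expf_eq0 /=.
  case/andP => q_gt0 ->; move/eqP: dX1;
    rewrite Ay0 mulr0 add0r mulf_eq0 (negPf fy).
  by rewrite expf_eq0 q_gt0 /= => ->.
have Ax_neq0 : Ax != 0.
  apply/eqP => Ax0; have gx := rational_or_nonzero h g_d g0 x_neq0 Ax0.
  move: y_neq0; apply/negP; rewrite negb_or !negbK.
  move/eqP: dY0; rewrite Ax0 mulr0 sub0r oppr_eq0 mulf_eq0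
    (negPf gx) expf_eq0 /=.
  case/andP => q_gt0 ->; move/eqP: dY1;
    rewrite Ax0 mulr0 add0r mulf_eq0 (negPf gx).
  by rewrite expf_eq0 q_gt0 /= => ->.
have q_gt0 : (0 < q)%N by apply: ltnW (finNzRing_gt1 k).
have x1_neq0 : x1 != 0.
  by apply: contra_neq Ax_neq0 => e;
    rewrite /Ax e expr0n gtn_eqF // !mulr0 subrr.
have y1_neq0 : y1 != 0.
  by apply: contra_neq Ay_neq0 => e;
    rewrite /Ay e expr0n gtn_eqF // !mulr0 subrr.
move: F0 dX0 dY0; rewrite (form2_dehom y0 f_d y1_neq0)
  (form2_dehom x0 g_d x1_neq0).
rewrite (deriv_form2_dehom x0 g_d x1_neq0)
  (deriv_form2_dehom y0 f_d y1_neq0) !exprSr.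
set s := x0 / x1; set t := y0 / y1.
have x0E : x0 = s * x1 by rewrite divfK.
have y0E : y0 = t * y1 by rewrite divfK.
have AxE : Ax = x1 ^+ q * x1 * (s ^+ q - s).
  by rewrite /Ax x0E frobenius_form_scale.
have AyE : Ay = y1 ^+ q * y1 * (t ^+ q - t).
  by rewrite /Ay y0E frobenius_form_scale.
have as_neq0 : s ^+ q - s != 0.
  by apply: contra_neq Ax_neq0 => e; rewrite AxE e mulr0.
have at_neq0 : t ^+ q - t != 0.
  by apply: contra_neq Ay_neq0 => e; rewrite AyE e mulr0.
rewrite AxE AyE => F0 dX0 dY0.
have [||||fE gE gf] := critical_pair _ _ _ _ as_neq0 at_neq0 F0 dX0 dY0;
  rewrite ?expf_neq0 //.
apply: (fg s t) gf; rewrite /root /crit_poly !hornerE.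
  by apply/eqP.
by apply/eqP.
Qed.

End Criterion.

(** * Critical values and quadratic elements *)

Section CriticalValues.
Variables (k : finFieldType) (K : fieldType) (h : {rmorphism k -> K}).
Local Notation q := #|k|.

(** When [p] has no root in [k], these are the values of [p / ('X^q - 'X)] at
    its critical points. *)
Definition critical_value (p : {poly K}) (c : K) :=
  exists2 t, root (crit_poly k p) t & c = - p^`().[t].

(** Each critical value comes from a root of [crit_poly k p], which has degree
    at most [2 q]. *)
Lemma size_critical_values (p : {poly K}) (s : seq K) :
    crit_poly k p != 0 -> (size p <= q.+2)%N -> uniq s ->
    (forall c, c \in s -> critical_value p c) ->
  (size s <= q.*2)%N.
Proof.
move=> b_neq0 size_p s_uniq s_crit.
have [ts [tsE ts_root]] : exists ts, map (fun t => - p^`().[t]) ts =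
  s /\ all (root (crit_poly k p)) ts.
  elim: s s_crit {s_uniq} => [|c s IH] s_crit; first by exists [::].
  have [|ts [<- ts_root]] := IH; first by move=> c' c's; apply: s_crit;
    rewrite inE c's orbT.
  have [t t_root ->] := s_crit c (mem_head _ _).
  by exists (t :: ts); split=> //=; rewrite t_root.
have ts_uniq : uniq ts by apply: (map_uniq (f := fun t => - p^`().[t]));
  rewrite tsE.
rewrite -tsE size_map -ltnS;
  apply: leq_trans (max_poly_roots b_neq0 ts_root ts_uniq) _.
have q_gt0 : (1 < q)%N := finNzRing_gt1 k.
rewrite /crit_poly; apply: leq_trans (size_polyD _ _) _; rewrite geq_max;
  apply/andP; split.
  apply: leq_trans size_p _; rewrite -addnn.
  by rewrite -addn2 leqW // leq_add2l.
apply: leq_trans (size_polyMleq _ _) _.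
have size_dp : (size p^`() <= q.+1)%N.
  by rewrite /deriv; apply: leq_trans (size_poly _ _) _;
    rewrite -subn1 leq_subLR.
have size_a : (size ('X^q - 'X : {poly K})%R <= q.+1)%N.
  apply: leq_trans (size_polyD _ _) _;
    rewrite size_polyN size_polyX size_polyXn.
  by rewrite geq_max leqnn ltnS ltnW.
rewrite -subn1 leq_subLR; apply: leq_trans (leq_add size_dp size_a) _.
by rewrite addSn addnS addnn.
Qed.

Lemma horner_frobenius (p : {poly k}) (t : K) :
  (map_poly h p).[t ^+ q] = (map_poly h p).[t] ^+ q.
Proof.
elim/poly_ind: p => [|p c IH].
  by rewrite rmorph0 !horner0 expr0n gtn_eqF // ltnW // finNzRing_gt1.
rewrite rmorphD rmorphM /= map_polyX map_polyC !hornerMXaddC IH.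
rewrite (exprDn_pchar _ _ (pnat_pchar_card h)) exprMn.
by rewrite -rmorphXn expf_card.
Qed.

Lemma dehom_map (f : {mpoly k[2]}) : dehom h f = map_poly h (dehom idfun f).
Proof.
rewrite /dehom [RHS](rmorph_form2 (map_poly h)); apply: eq_bigr => m _.
rewrite /= map_polyC; congr (_ * _); apply: eq_bigr => j _; congr (_ ^+ _).
by rewrite /pair2; case: ifP => _; rewrite ?map_polyX // rmorph1.
Qed.

(** The form [f] has coefficients in [k], so Frobenius permutes its critical
    points. *)
Lemma critical_value_frobenius (f : {mpoly k[2]}) (c : K) :
  critical_value (dehom h f) c -> critical_value (dehom h f) (c ^+ q).
Proof.
case=> t t_root ->; exists (t ^+ q).
  have critE : crit_poly k (dehom h f)
      = map_poly h (dehom idfun f + (dehom idfun f)^`() * ('X^q - 'X)).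
    rewrite /crit_poly dehom_map rmorphD rmorphM rmorphB /= map_polyXn
      map_polyX.
    by rewrite deriv_map.
  move: t_root; rewrite critE /root horner_frobenius => /eqP->.
  by rewrite expr0n gtn_eqF // ltnW // finNzRing_gt1.
by rewrite dehom_map deriv_map horner_frobenius exprNn_pchar // pnat_pchar_card.
Qed.

Lemma size_dehom (f : {mpoly k[2]}) d : f \is d.-homog ->
    (size (dehom h f) <= d.+1)%N.
Proof.
move=> /dhomogP f_d; apply: leq_trans (size_sum _ _ _) _.
rewrite big_seq; elim/big_ind: _ => [|x y xd yd|m /f_d md] //;
  first by rewrite geq_max xd.
rewrite mul_polyC; apply: leq_trans (size_scale_leq _ _) _.
rewrite /mmap1 big_ord_recl big_ord1 /pair2 /= expr1n mulr1 size_polyXn ltnS.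
by rewrite -md /= mdegE (bigD1 ord0) //= leq_addr.
Qed.

(** At a rational point [crit_poly] takes the value of [f] itself. *)
Lemma crit_dehom_neq0 (f : {mpoly k[2]}) :
  no_rational_point f -> crit_poly k (dehom h f) != 0.
Proof.
move=> f_nopoint; apply: contraTneq
  (no_rational_zero h f_nopoint (a := 0) (b := 1) _);
  last by rewrite oner_eq0 orbT.
move/(congr1 (horner^~ (h 0)));
  rewrite /crit_poly !hornerE ?hornerXn horner_dehom.
rewrite -rmorphXn expr0n gtn_eqF ?subrr; last by rewrite ltnW // finNzRing_gt1.
by rewrite mulr0 addr0 rmorph1 => ->; rewrite eqxx.
Qed.

End CriticalValues.

Section QuadraticExtension.
Variables (k : finFieldType) (K : closedFieldType) (h : {rmorphism k -> K}).
Local Notation q := #|k|.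

(** The elements of [F_{q^2}] outside [F_q]: the [q^2] roots of the separable
    polynomial ['X^(q * q) - 'X], less the at most [q] roots of ['X^q - 'X]. *)
Lemma quadratic_elements : exists s : seq K,
  [/\ uniq s, (q * q - q <= size s)%N &
      forall c, c \in s -> c ^+ q != c /\ c ^+ q ^+ q = c].
Proof.
have q_gt1 : (1 < q)%N := finNzRing_gt1 k.
have q_gt0 := ltnW q_gt1.
pose p : {poly K} := 'X^(q * q) - 'X.
have size_XnX n : (1 < n)%N -> size ('X^n - 'X : {poly K}) = n.+1.
  by move=> n_gt1; rewrite size_polyDl ?size_polyXn // size_polyN size_polyX.
have qq_gt1 : (1 < q * q)%N by rewrite (leq_trans q_gt1) // leq_pmulr.
have size_p : size p = (q * q).+1 by apply: size_XnX.
have [rs pE] := closed_field_poly_normal p.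
have lp : lead_coef p = 1.
  by rewrite lead_coefDl ?lead_coefXn // size_polyN size_polyX size_polyXn.
rewrite lp scale1r in pE.
have rs_uniq : uniq rs.
  rewrite -separable_prod_XsubC -pE separable_poly.unlock /p derivB derivXn
    derivX.
  have -> : 'X^((q * q).-1) *+ (q * q) = 0 :> {poly K}.
    by rewrite mulrnA -mulr_natl (natr_card (polyC \o h)) mul0r.
  by rewrite sub0r -[- 1]scaleN1r coprimepZr ?coprimep1 // oppr_eq0 oner_eq0.
have size_rs : size rs = (q * q)%N.
  by apply: succn_inj; rewrite -size_p pE size_prod_XsubC.
exists [seq c <- rs | c ^+ q != c]; split; first exact: filter_uniq.
  have := count_predC (fun c => c ^+ q == c) rs; rewrite size_rs => qqE.
  rewrite leq_subLR -qqE size_filter leq_add2r -size_filter -ltnS -(size_XnX q)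
    //.
  apply: max_poly_roots; last exact: filter_uniq.
    by rewrite -size_poly_gt0 size_XnX.
  by apply/allP => c; rewrite mem_filter /root !hornerE ?hornerXn subr_eq0 =>
    /andP[].
move=> c; rewrite mem_filter => /andP[cq]; rewrite -root_prod_XsubC -pE.
by rewrite /root /p !hornerE ?hornerXn subr_eq0 => /eqP cqq; rewrite -exprM.
Qed.

End QuadraticExtension.

(** * Members of the family with few critical values *)

(** With [T] and [N] the trace and the norm of a quadratic element, the value of
    this form at a rational point is that of the norm form of the quadratic
    extension, while its critical points are only the element and its
    conjugate. *)
Definition quadratic_form (k : nzRingType) (q : nat) (T N : k) : {mpoly k[2]} :=
  'X_0 ^+ q.+1 - T *: ('X_0 ^+ q * 'X_1) + N *: 'X_1 ^+ q.+1.

Lemma dhomog_varX (R : nzRingType) (i : 'I_2) n :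
    ('X_i ^+ n : {mpoly R[2]}) \is n.-homog.
Proof. by rewrite -[n in n.-homog]mul1n dhomogMn // dhomogX /= mdeg1. Qed.

Section Forms.
Variables (R S : comNzRingType) (h : {rmorphism R -> S}).

Lemma form2_quadratic q T N (a b : S) :
  form2 h (quadratic_form q T N) a b =
    a ^+ q.+1 - h T * (a ^+ q * b) + h N * b ^+ q.+1.
Proof.
pose phi : {rmorphism {mpoly R[2]} -> S} := mmap h (pair2 a b).
have phiX i : phi 'X_i = pair2 a b i by rewrite /phi /= mmapX mmap1U.
have phiC c : phi c%:MP = h c by rewrite /phi /= mmapC.
rewrite -[LHS]/(phi _) /quadratic_form -!mul_mpolyC.
rewrite (rmorphD phi) (rmorphB phi) !(rmorphM phi) !(rmorphXn phi) !phiX !phiC.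
by [].
Qed.

Lemma form2_square (a b : S) :
  form2 h (('X_0 ^+ 2 + 'X_1 ^+ 2) ^+ 2) a b = (a ^+ 2 + b ^+ 2) ^+ 2.
Proof.
pose phi : {rmorphism {mpoly R[2]} -> S} := mmap h (pair2 a b).
have phiX i : phi 'X_i = pair2 a b i by rewrite /phi /= mmapX mmap1U.
by rewrite -[LHS]/(phi _) (rmorphXn phi) (rmorphD phi) !(rmorphXn phi) !phiX.
Qed.

End Forms.

Lemma dhomog_quadratic_form (k : nzRingType) (q : nat) (T N : k) :
  quadratic_form q T N \is q.+1.-homog.
Proof.
rewrite /quadratic_form dhomogD ?dhomogZ ?dhomog_varX // rpredB ?dhomogZ
  ?dhomog_varX //.
by rewrite -[q.+1]addn1 dhomogM ?dhomog_varX // dhomogX /= mdeg1.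
Qed.

Lemma dhomog_square (k : nzRingType) :
  (('X_0 ^+ 2 + 'X_1 ^+ 2) ^+ 2 : {mpoly k[2]}) \is 4.-homog.
Proof. by rewrite (dhomogMn (d := 2) 2) // dhomogD ?dhomog_varX. Qed.

Lemma no_rational_pointP (k : fieldType) (f : {mpoly k[2]}) :
    (forall a b, (a != 0) || (b != 0) -> form2 idfun f a b != 0) ->
  no_rational_point f.
Proof.
move=> f_neq0 y /row2_neq0/f_neq0; rewrite /form2 /meval.
rewrite (eq_mmap _ (w := y 0)) // => j.
by rewrite /pair2; have [->|->] := ord2P j.
Qed.

Section Quadratic.
Variables (k : finFieldType) (K : fieldType) (h : {rmorphism k -> K}).
Local Notation q := #|k|.
Variables (mu : K) (T N : k).
Hypotheses (hT : h T = mu + mu ^+ q) (hN : h N = mu * mu ^+ q).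
Hypotheses (mu_q : mu ^+ q != mu) (mu_qq : mu ^+ q ^+ q = mu).

(** On [k] the form agrees with [a^2 - T a b + N b^2], which splits into [(a -
    mu b) (a - mu^q b)]. *)
Lemma quadratic_no_rational_point : no_rational_point (quadratic_form q T N).
Proof.
apply: no_rational_pointP => a b ab_neq0.
rewrite -(fmorph_eq0 h) form2_quadratic !exprS !expf_card /=.
have -> : h (a * a - T * (a * b) + N * (b * b)) =
  (h a - mu * h b) * (h a - mu ^+ q * h b).
  by rewrite rmorphD rmorphB !rmorphM hT hN /=; move: (mu ^+ _) => nu; ring.
have norat c : c ^+ q != c -> h a - c * h b != 0.
  move=> cq; apply: contraNneq cq => /eqP; rewrite subr_eq0 => /eqP acb.
  have b_neq0 : h b != 0.
    apply: contraTneq ab_neq0 => b0.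
    by rewrite negb_or !negbK -!(fmorph_eq0 h) acb b0 mulr0 eqxx.
  have -> : c = h (a / b) by rewrite rmorphM fmorphV acb mulfK.
  by rewrite -rmorphXn expf_card.
by rewrite mulf_neq0 ?norat // mu_qq eq_sym.
Qed.

Lemma dehom_quadratic :
  dehom h (quadratic_form q T N) = 'X^(q.+1) - (h T)%:P * 'X^q + (h N)%:P.
Proof. by rewrite /dehom (form2_quadratic (polyC \o h)) expr1n !mulr1. Qed.

Lemma deriv_dehom_quadratic (s : K) :
  (dehom h (quadratic_form q T N))^`().[s] = s ^+ q.
Proof.
rewrite dehom_quadratic derivD derivB derivC addr0 mul_polyC derivZ !derivXn.
rewrite hornerD hornerN hornerZ !hornerMn !hornerXn.
have q0 (z : K) : z *+ q = 0 by rewrite -mulr_natl (natr_card h) mul0r.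
by rewrite mulrS !q0 mulr0 subr0 addr0.
Qed.

(** Because [T] and [N] are fixed by Frobenius, [crit_poly] of this form is the
    [q]-th power of the quadratic polynomial with roots [mu] and [mu ^+ q]. *)
Lemma root_crit_quadratic (s : K) :
  root (crit_poly k (dehom h (quadratic_form q T N))) s -> s = mu \/ s =
    mu ^+ q.
Proof.
rewrite /root /crit_poly hornerD hornerM deriv_dehom_quadratic dehom_quadratic.
rewrite !hornerD !hornerN hornerM !hornerXn hornerX !hornerC => /eqP r0.
have /eqP : ((s - mu) * (s - mu ^+ q)) ^+ q = 0.
  have fr := exprDn_pchar _ _ (pnat_pchar_card h).
  have frN := exprNn_pchar _ (pnat_pchar_card h).
  rewrite exprMn !fr !frN mu_qq -[RHS]r0 hT hN exprS;
    move: (s ^+ q) (mu ^+ q) => u v.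
  ring.
rewrite expf_eq0 mulf_eq0 !subr_eq0 => /andP[_ /orP[]/eqP->];
  [by left | by right].
Qed.

End Quadratic.

Section CardThree.
Variables (k : finFieldType) (K : fieldType) (h : {rmorphism k -> K}).
Hypothesis card_k : #|k| = 3%N.

Let three0 (S : nzRingType) (e : {rmorphism k -> S}) : 3%:R = 0 :> S.
Proof. by rewrite -card_k (natr_card e). Qed.

Lemma square_no_rational_point :
  no_rational_point (('X_0 ^+ 2 + 'X_1 ^+ 2) ^+ 2 : {mpoly k[2]}).
Proof.
apply: no_rational_pointP => a b ab_neq0; rewrite form2_square expf_neq0 //.
apply: contraTneq ab_neq0 => ab0.
have cube (c : k) : c ^+ 3 = c by rewrite -card_k expf_card.
have two : 2%:R = -1 :> k.
  by apply/eqP; rewrite -subr_eq0 opprK -[1 in X in _ + X]/(1%:R) -natrD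
    (three0 idfun).
have b0 : b = 0.
  have ab : a = - (a * b ^+ 2).
    apply/eqP; rewrite -subr_eq0 opprK -{1}(cube a); apply/eqP.
    by rewrite -[RHS](mulr0 a) -ab0; ring.
  have ba : a * b = 0.
    have e : a * b = - (a * b) by rewrite {1}ab mulNr -mulrA -exprSr cube.
    have : 2%:R * (a * b) = 0 by rewrite mulr_natl mulr2n {1}e addNr.
    by rewrite two mulN1r => /eqP; rewrite oppr_eq0 => /eqP.
  have : b ^+ 4 = 0.
    have -> : b ^+ 4 = (a ^+ 2 + b ^+ 2) * b ^+ 2 - (a * b) ^+ 2 by ring.
    by rewrite ab0 ba mul0r expr0n subr0.
  by move/eqP; rewrite expf_eq0 => /eqP.
move: ab0; rewrite b0 expr0n addr0 => /eqP; rewrite expf_eq0 => /eqP->.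
by rewrite eqxx.
Qed.

Lemma dehom_square : dehom h (('X_0 ^+ 2 + 'X_1 ^+ 2) ^+ 2) =
    ('X ^+ 2 + 1) ^+ 2.
Proof. by rewrite /dehom (form2_square (polyC \o h)) expr1n. Qed.

(** In characteristic 3 the critical points are the roots of [s^2 + 1], of
    critical value 0, and of [s^4 + 1], whose critical values have square 1: all
    of them lie in the prime field. *)
Lemma critical_value_square (s : K)
    (r := dehom h (('X_0 ^+ 2 + 'X_1 ^+ 2) ^+ 2)) :
  root (crit_poly k r) s -> r^`().[s] ^+ 3 = r^`().[s].
Proof.
rewrite /root /crit_poly /r dehom_square card_k !(derivE, deriv_exp) !hornerE.
have t0 : 3%:R = 0 :> K by apply: three0 h.
have -> : (s + s) * (s ^+ 2 + 1) + (s ^+ 2 + 1) * (s + s) = s * (s ^+ 2 + 1).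
  rewrite -[RHS]addr0 -(mul0r (s * (s ^+ 2 + 1))) -t0; ring.
have -> : (s ^+ 2 + 1) ^+ 2 + s * (s ^+ 2 + 1) * (s ^+ 3 - s) =
  (s ^+ 2 + 1) * (s ^+ 4 + 1).
  by ring.
rewrite mulf_eq0 => /orP[/eqP->|]; first by rewrite mulr0 expr0n.
rewrite addr_eq0 => /eqP s4; have sq : (s * (s ^+ 2 + 1)) ^+ 2 = 1.
  have -> : (s * (s ^+ 2 + 1)) ^+ 2 =
    s ^+ 2 * (s ^+ 4 + 1) + 3%:R * s ^+ 4 - s ^+ 4 by ring.
  by rewrite s4 t0 addNr mulr0 mul0r !add0r opprK.
by rewrite exprS sq mulr1.
Qed.

End CardThree.

Section SmoothCurve.
Variables (k : finFieldType) (K : closedFieldType) (h : {rmorphism k -> K}).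
Local Notation q := #|k|.

(** If some quadratic element [mu] is not a critical value of [f / A], neither
    is its conjugate, and the quadratic form of [mu] avoids all critical values
    of [f / A]. Otherwise these at most [2 q] values contain the [q^2 - q]
    quadratic elements, so [q = 3] and there is no room for a critical value in
    [F_3], where all those of [(X_0^2 + X_1^2)^2] lie. *)
Lemma smooth_member (f : {mpoly k[2]}) :
    odd q -> f \is q.+1.-homog -> no_rational_point f ->
  exists2 g : {mpoly k[2]}, g \is q.+1.-homog & smooth_over h (curve_eq q f g).
Proof.
move=> q_odd f_d f_nopoint.
have [s [s_uniq size_s s_quad]] := quadratic_elements h.
have bound := size_critical_values (crit_dehom_neq0 h f_nopoint)
  (size_dehom h f_d).
have [s_crit|] := pselect (forall c, c \in s -> critical_value k (dehom h f) c);
  last first.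
  case/existsNP => mu /not_implyP[mu_s mu_crit].
  have [mu_q mu_qq] := s_quad mu mu_s.
  have qP := pnat_pchar_card h.
  (* The trace and the norm of [mu] are fixed by Frobenius. *)
  have [T hT] : exists T, mu + mu ^+ q = h T.
    by apply: fixed_frobenius; rewrite (exprDn_pchar _ _ qP) mu_qq addrC.
  have [N hN] : exists N, mu * mu ^+ q = h N.
    by apply: fixed_frobenius; rewrite exprMn mu_qq mulrC.
  exists (quadratic_form q T N); first exact: dhomog_quadratic_form.
  apply: smooth_criterion => //; first exact: dhomog_quadratic_form.
    exact: (quadratic_no_rational_point (esym hT) (esym hN) mu_q mu_qq).
  move=> z t t_root /(root_crit_quadratic (esym hT) (esym hN) mu_qq) z_mu.
  rewrite deriv_dehom_quadratic => zq; apply: mu_crit.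
  have zq_crit : critical_value k (dehom h f) (z ^+ q) by exists t.
  case: z_mu zq_crit => ->; last by rewrite mu_qq.
  by move/critical_value_frobenius; rewrite mu_qq.
have q_gt1 : (1 < q)%N := finNzRing_gt1 k.
have size_s2 := leq_trans size_s (bound s s_uniq s_crit).
have q3 : q = 3%N.
  move: q_odd q_gt1 size_s2; rewrite -muln2 -[X in (_ - X)%N]muln1 -mulnBr.
  by case: (q) => [|[|[|[|n]]]] //= _ _; rewrite leq_pmul2l // subn1.
exists (('X_0 ^+ 2 + 'X_1 ^+ 2) ^+ 2); first by rewrite q3 dhomog_square.
apply: smooth_criterion => //; first by rewrite q3 dhomog_square.
  exact: square_no_rational_point.
move=> z t t_root /(critical_value_square q3); set c := _.[z] => c3 ct.
(* [c] is fixed by Frobenius, unlike the elements of [s]. *)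
have c_notin : c \notin s.
  by apply/negP => /s_quad[]; rewrite q3 c3 eqxx.
have : (size (c :: s) <= q.*2)%N.
  apply: bound => [|c']; first by rewrite /= c_notin.
  by rewrite inE => /orP[/eqP->|/s_crit] //; exists t.
by rewrite leqNgt /= ltnS => /negP[]; apply: leq_trans size_s; rewrite q3.
Qed.

End SmoothCurve.

(** * Primes of the affine plane over a finite field *)

(** Primes are propositional predicates here because the ones cut out by a chart
    are defined by an existential over a fraction field. *)
Record prime_ideal (S : comNzRingType) (Q : S -> Prop) : Prop := PrimeIdeal {
  prime_ideal0 : Q 0;
  prime_ideal1 : ~ Q 1;
  prime_idealD : forall u v, Q u -> Q v -> Q (u + v);
  prime_idealM : forall a u, Q u -> Q (a * u);
  prime_ideal_split : forall u v, Q (u * v) -> Q u \/ Q v }.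

Section PrimeIdeal.
Variables (S : comNzRingType) (Q : S -> Prop) (Q_prime : prime_ideal Q).

Lemma prime_idealN u : Q u -> Q (- u).
Proof. by rewrite -mulN1r; apply: prime_idealM. Qed.

Lemma prime_idealB u v : Q u -> Q v -> Q (u - v).
Proof. by move=> Qu Qv; apply: prime_idealD => //; apply: prime_idealN. Qed.

Lemma prime_idealX u n : Q (u ^+ n) -> Q u.
Proof.
elim: n => [|n IH]; first by move/(prime_ideal1 Q_prime).
by rewrite exprS => /(prime_ideal_split Q_prime)[].
Qed.

End PrimeIdeal.

(** A nonzero [h] of minimal degree in [Q0] has no factor in common with an
    element [w] outside [Q0], unless [Q0] already contains a nonzero constant: a
    common factor, or its cofactor in [h], would lie in [Q0]. So the resultant
    of [h] and [w] is a nonzero constant, and it lies in [Q1]. *)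
Lemma elimination_ideal_neq0 (R : idomainType) (Q0 Q1 : {poly R} -> Prop)
    (h w : {poly R}) :
    prime_ideal Q0 -> prime_ideal Q1 -> (forall u, Q0 u -> Q1 u) ->
    Q0 h -> h != 0 -> Q1 w -> ~ Q0 w ->
  exists2 c : R, c != 0 & Q1 c%:P.
Proof.
move=> Q0_prime Q1_prime Q01 Q0h h_neq0 Q1w nQ0w.
have [[c c_neq0 Q0c]|noc] := pselect (exists2 c : R, c != 0 & Q0 c%:P).
  by exists c => //; apply: Q01.
pose P n := `[< exists2 u, Q0 u & (u != 0) && (size u == n) >].
have exP : exists n, P n.
  by exists (size h); apply/asboolP; exists h; rewrite ?h_neq0 /=.
have [n /asboolP[{}h {}Q0h /andP[{}h_neq0 /eqP size_h]] n_min] := ex_minnP exP.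
have const_Q0 c : Q0 c%:P -> c = 0.
  by move=> Q0c; apply: contra_notP noc => /eqP; exists c.
have size_h_gt1 : (1 < size h)%N.
  rewrite ltnNge; apply/negP => /size1_polyC hE.
  by move: h_neq0; rewrite hE in Q0h *; rewrite (const_Q0 _ Q0h) eqxx.
have w_neq0 : w != 0 by apply: contra_notN nQ0w => /eqP->; apply: prime_ideal0.
have [/size1_polyC wE|size_w_gt1] := leqP (size w) 1.
  by exists w`_0; rewrite -?wE // -polyC_eq0 -wE.
have [|res_neq0] := eqVneq (resultant h w) 0; last first.
  exists (resultant h w) => //.
  have [[a b] /= _ ->] := resultant_in_ideal size_h_gt1 size_w_gt1.
  by apply: prime_idealD => //; apply: prime_idealM => //; apply: Q01.
move/eqP; rewrite resultant_eq0; set d := Pdiv.Idomain.gcdp _ _ => size_d.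
have /Pdiv.Idomain.dvdpP[[c e] /= c_neq0 hE] : Pdiv.Idomain.dvdp d h.
  exact: Pdiv.Idomain.dvdp_gcdl.
have /Pdiv.Idomain.dvdpP[[c' e'] /= c'_neq0 wE] : Pdiv.Idomain.dvdp d w.
  exact: Pdiv.Idomain.dvdp_gcdr.
have : Q0 (e * d) by rewrite -hE -mul_polyC; apply: prime_idealM.
case/(prime_ideal_split Q0_prime) => [Q0e|Q0d]; last first.
  have : Q0 (c'%:P * w) by rewrite mul_polyC wE; apply: prime_idealM.
  case/(prime_ideal_split Q0_prime) => // /const_Q0 c'0.
  by rewrite c'0 eqxx in c'_neq0.
have ed_neq0 : e * d != 0 by rewrite -hE scale_poly_eq0 negb_or c_neq0.
have e_neq0 : e != 0 by apply: contra_neq ed_neq0 => ->; rewrite mul0r.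
have d_neq0 : d != 0 by apply: contra_neq ed_neq0 => ->; rewrite mulr0.
have /n_min : P (size e) by apply/asboolP; exists e; rewrite ?e_neq0 /=.
rewrite leqNgt => /negP[].
rewrite -size_h -(size_scale h c_neq0) hE size_mul //.
case: (size d) size_d => [|[|m]] // _.
by rewrite -subn1 addnS subn1 /= addnS ltnS leq_addr.
Qed.

Lemma poly2_ring_ind (R : nzRingType) (T : {poly {poly R}} -> Prop) :
    (forall c, T c%:P%:P) -> T 'X%:P -> T 'X ->
    (forall u v, T u -> T v -> T (u + v)) ->
    (forall u v, T u -> T v -> T (u * v)) -> forall u, T u.
Proof.
move=> TC TX TY TD TM; elim/poly_ind => [|u c Tu]; first exact: (TC 0).
apply: (TD); first exact: TM.
elim/poly_ind: c => [|v c Tv]; first exact: (TC 0).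
by rewrite polyCD polyCM; apply: TD => //; apply: TM.
Qed.

Section FiniteResidueField.
Variables (k : finFieldType) (S : comNzRingType) (Q : S -> Prop) (p : nat).
Hypotheses (Q_prime : prime_ideal Q) (p_pr : prime p) (S_p : p \in [pchar S]).

Let pnat_p n : [pchar S].-nat (p ^ n)%N.
Proof. by rewrite (eq_pnat _ (pcharf_eq S_p)) pnatX pnat_id. Qed.

Let frobB (u v : S) n : (u - v) ^+ (p ^ n) = u ^+ (p ^ n) - v ^+ (p ^ n).
Proof. by rewrite exprDn_pchar // exprNn_pchar. Qed.

(** Over a finite field, being algebraic modulo [Q] amounts to being fixed
    modulo [Q] by a power of Frobenius. This form is closed under sums and
    products without any linear algebra. *)
Definition frobenius_periodic (u : S) := exists2 n,
    (0 < n)%N & Q (u ^+ (p ^ n) - u).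

Lemma frobenius_periodic_mul u n m : Q (u ^+ (p ^ n) - u) ->
    Q (u ^+ (p ^ (n * m)) - u).
Proof.
move=> Qu; elim: m => [|m IH]; first by rewrite muln0 expn0 expr1 subrr;
  apply: prime_ideal0.
rewrite mulnS expnD exprM.
have -> : (u ^+ (p ^ n)) ^+ (p ^ (n * m)) - u
   = (u ^+ (p ^ n) - u) ^+ (p ^ (n * m)) + (u ^+ (p ^ (n * m)) - u).
  by rewrite frobB addrA subrK.
apply: prime_idealD => //.
have : (0 < p ^ (n * m))%N by rewrite expn_gt0 prime_gt0.
by case: (p ^ _)%N => // e _; rewrite exprSr; apply: prime_idealM.
Qed.

Lemma frobenius_periodicD u v :
  frobenius_periodic u -> frobenius_periodic v -> frobenius_periodic (u + v).
Proof.
move=> [n n0 Qu] [m m0 Qv]; exists (n * m)%N; first by rewrite muln_gt0 n0.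
have -> : (u + v) ^+ (p ^ (n * m)) - (u + v)
        = (u ^+ (p ^ (n * m)) - u) + (v ^+ (p ^ (m * n)) - v).
  by rewrite exprDn_pchar // [(m * n)%N]mulnC; ring.
by apply: (prime_idealD Q_prime);
  [exact: frobenius_periodic_mul Qu | exact: frobenius_periodic_mul Qv].
Qed.

Lemma frobenius_periodicM u v :
  frobenius_periodic u -> frobenius_periodic v -> frobenius_periodic (u * v).
Proof.
move=> [n n0 Qu] [m m0 Qv]; exists (n * m)%N; first by rewrite muln_gt0 n0.
have -> : (u * v) ^+ (p ^ (n * m)) - u * v
        = v ^+ (p ^ (m * n)) * (u ^+ (p ^ (n * m)) - u) + u *
          (v ^+ (p ^ (m * n)) - v).
  by rewrite exprMn [(m * n)%N]mulnC; ring.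
apply: (prime_idealD Q_prime); apply: (prime_idealM Q_prime).
  exact: frobenius_periodic_mul Qu.
exact: frobenius_periodic_mul Qv.
Qed.

Lemma frobenius_periodic_const (rho : {rmorphism k -> S}) (c : k) :
  frobenius_periodic (rho c).
Proof.
have k_p : p \in [pchar k] by rewrite -(fmorph_pchar rho).
have k_gt1 := finNzRing_gt1 k.
have kE : #|k| = (p ^ logn p #|k|)%N := card_pprimeChar k_p.
exists (logn p #|k|).
  by move: k_gt1; rewrite {1}kE; case: (logn _ _).
by rewrite -kE -rmorphXn expf_card subrr; apply: prime_ideal0.
Qed.

(** Among the residues modulo [c] of ['X^(p ^ n)], finite in number, two
    coincide; their difference is a power of ['X^(p ^ (j - i)) - 'X]. *)
Lemma frobenius_periodic_root (rho : {rmorphism {poly k} -> S}) (c : {poly k}) :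
  c != 0 -> Q (rho c) -> frobenius_periodic (rho 'X).
Proof.
move=> c_neq0 Qc; pose m := size c.
pose r n : 'rV[k]_m := poly_rV ('X^(p ^ n) %% c).
have [i [j [ij rij]]] : exists i j, (i < j)%N /\ r i = r j.
  pose N := #|{: 'rV[k]_m}|.
  have /injectivePn[a [b ab rab]] : ~~ injectiveb (fun i : 'I_N.+1 => r i).
    apply/injectiveP => r_inj; have := leq_card _ r_inj.
    by rewrite card_ord ltnn.
  case: (ltngtP a b) => [ltab|ltba|eqab]; first by exists a, b.
    by exists b, a.
  by rewrite (val_inj eqab) eqxx in ab.
have c_dvd : c %| 'X^(p ^ j) - 'X^(p ^ i).
  have rK n : rVpoly (r n) =
    'X^(p ^ n) %% c by rewrite poly_rV_K // ltnW // ltn_modp.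
  by rewrite /dvdp modpD modpN -!rK rij subrr.
exists (j - i)%N; first by rewrite subn_gt0.
apply: (prime_idealX Q_prime (n := p ^ i)).
rewrite frobB -exprM -expnD subnK 1?ltnW // -!rmorphXn -rmorphB.
by have /dvdpP[e ->] := c_dvd; rewrite rmorphM; apply: prime_idealM.
Qed.

(** If [u] is in [Q'] but not in [Q], then [u * (u ^+ e - 1)] in [Q] puts [u ^+
    e - 1], hence 1, in [Q']. *)
Lemma frobenius_periodic_maximal (Q' : S -> Prop) u :
  prime_ideal Q' -> (forall v, Q v -> Q' v) -> frobenius_periodic u -> Q' u ->
    Q u.
Proof.
move=> Q'_prime QQ' [n n_gt0 Qu] Q'u.
have : (1 < p ^ n)%N by rewrite -(expn0 p) ltn_exp2l // prime_gt1.
case: (p ^ n)%N Qu => [|[|e]] // Qu _.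
have : Q (u * (u ^+ e.+1 - 1)) by rewrite mulrBr mulr1 -exprS.
case/(prime_ideal_split Q_prime) => // /QQ' Q'ue; case: (prime_ideal1 Q'_prime).
rewrite -(subKr (u ^+ e.+1) 1); apply: prime_idealB => //.
by rewrite exprSr; apply: prime_idealM.
Qed.

End FiniteResidueField.

(** The prime [Q1] contains a nonzero polynomial in each variable alone, so both
    variables, hence all polynomials, are periodic under Frobenius modulo [Q1],
    which makes [Q1] maximal. *)
Lemma affine_plane_no_chain (k : finFieldType)
    (Q0 Q1 Q2 : {poly {poly k}} -> Prop)
    (h w : {poly {poly k}}) :
    prime_ideal Q0 -> prime_ideal Q1 -> prime_ideal Q2 ->
    (forall u, Q0 u -> Q1 u) -> (forall u, Q1 u -> Q2 u) ->
    Q0 h -> h != 0 -> Q1 w -> ~ Q0 w ->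
  forall u, Q2 u -> Q1 u.
Proof.
move=> Q0_prime Q1_prime Q2_prime Q01 Q12 Q0h h_neq0 Q1w nQ0w.
have [p p_pr k_p] := finPcharP k.
have S_p : p \in [pchar {poly {poly k}}] by rewrite 2!pchar_poly.
have [c c_neq0 Q1c] :=
  elimination_ideal_neq0 Q0_prime Q1_prime Q01 Q0h h_neq0 Q1w nQ0w.
(* The other variable is reached by exchanging the two. *)
have swap_prime Q : prime_ideal Q ->
  prime_ideal (fun u : {poly {poly k}} => Q (swapXY u)).
  move=> Q_prime; split => [||u v|a u|u v];
    rewrite ?raddf0 ?rmorph1 ?raddfD ?rmorphM.
  - exact: prime_ideal0.
  - exact: prime_ideal1.
  - exact: prime_idealD.
  - exact: prime_idealM.
  - exact: prime_ideal_split.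
have [d d_neq0 Q1d] : exists2 d : {poly k}, d != 0 & Q1 (swapXY d%:P).
  apply: (elimination_ideal_neq0 (swap_prime _ Q0_prime) (swap_prime _ Q1_prime)
    (fun u => Q01 (swapXY u)) (h := swapXY h) (w := swapXY w));
      rewrite ?swapXYK //.
  by rewrite swapXY_eq0.
have per u : frobenius_periodic Q1 p u.
  elim/poly2_ring_ind: u => [a| | |u v|u v].
  - exact: (frobenius_periodic_const Q1_prime S_p (polyC \o polyC)).
  - exact: (frobenius_periodic_root Q1_prime p_pr S_p
    (rho := polyC) c_neq0 Q1c).
  - have := frobenius_periodic_root Q1_prime p_pr S_p
    (rho := swapXY \o polyC) d_neq0 Q1d.
    by rewrite /= swapXY_Y.
  - exact: frobenius_periodicD.
  - exact: frobenius_periodicM.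
move=> u; exact: (frobenius_periodic_maximal Q1_prime p_pr Q2_prime Q12
  (per u)).
Qed.

(** * Affine charts and the upper bound on the dimension *)

Lemma mcoeff_pihomog (n : nat) (R : nzRingType) (mf : measure n) (d : nat)
    (p : {mpoly R[n]}) (m : 'X_{1..n}) :
  (pihomog mf d p)@_m = if mf m == d then p@_m else 0.
Proof.
have -> : p@_m = \sum_(m' <- msupp p) (p@_m' *: 'X_[m'])@_m.
  by rewrite {1}[p]mpolyE raddf_sum.
rewrite pihomogE raddf_sum /=; case: ifP => md; last first.
  apply: big1 => m' /eqP m'd; rewrite mcoeffZ mcoeffX.
  by case: (m' =P m) m'd => [->|_ _]; rewrite ?mulr0 // => /eqP; rewrite md.
rewrite big_mkcond; apply: eq_bigr => m' _; case: ifP => // m'd.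
by rewrite mcoeffZ mcoeffX; case: (m' =P m) m'd => [->|_ _]; rewrite ?md ?mulr0.
Qed.

Definition bihomog (R : nzRingType) (a b : nat) (p : {mpoly R[2 + 2]}) :=
  forall m, m \in msupp p -> degX m = a /\ degY m = b.

Lemma bihomog_pihomog (R : nzRingType) (a b : nat) (p : {mpoly R[2 + 2]}) :
  bihomog a b (pihomog degY b (pihomog degX a p)).
Proof.
move=> m; rewrite mcoeff_msupp !mcoeff_pihomog /=.
by case: (degY m =P b) => [mb|_]; [case: (degX m =P a) => [ma|_]|];
  rewrite ?eqxx.
Qed.

(** The two scaling factors of bihomogeneous coordinates come out separately;
    here [w] is the point [(s x, t y)] for [v = (x, y)]. *)
Lemma mmap_scale_bihomog (R : nzRingType) (S : comNzRingType) (h : R -> S)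
    (a b : nat) (s t : S) (v w : 'I_(2 + 2) -> S) (p : {mpoly R[2 + 2]}) :
    bihomog a b p ->
    (forall i, w (lshift 2 i) = s * v (lshift 2 i)) ->
    (forall j, w (rshift 2 j) = t * v (rshift 2 j)) ->
  mmap h w p = s ^+ a * t ^+ b * mmap h v p.
Proof.
move=> p_ab wX wY; rewrite mulr_sumr; apply: eq_big_seq => m /p_ab[<- <-].
rewrite mulrCA; congr (_ * _); rewrite /mmap1 !big_split_ord /=.
rewrite /degX /degY -!prodrXr [RHS]mulrACA.
by congr (_ * _); rewrite -big_split; apply: eq_bigr => i _;
  rewrite ?wX ?wY exprMn.
Qed.

Lemma mpoly_mmap_id (n : nat) (R S : comNzRingType)
    (phi : {rmorphism {mpoly R[n]} -> S})
    (p : {mpoly R[n]}) : phi p =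
      mmap (phi \o @mpolyC n R) (fun i => phi 'X_i) p.
Proof.
rewrite {1}[p]mpolyE rmorph_sum; apply: eq_bigr => m _.
rewrite -mul_mpolyC rmorphM; congr (_ * _).
by rewrite mpolyXE_id rmorph_prod; apply: eq_bigr => i _; rewrite rmorphXn.
Qed.

Section BihomogeneousPrime.
Variables (k : fieldType) (P : {pred {mpoly k[2 + 2]}}).

Lemma bihomog_component (p : {mpoly k[2 + 2]}) :
    idealr_closed P -> p \notin P ->
  exists a b, pihomog degY b (pihomog degX a p) \notin P.
Proof.
move=> [P0 _ PD] pP.
have comp (mf : measure (2 + 2)) r : r \notin P -> exists d,
  pihomog mf d r \notin P.
  move=> rP.
  have [/forallP rdP|] :=
    boolP [forall d : 'I_(mmeasure mf r), pihomog mf d r \in P].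
    case/negP: rP; rewrite [r](pihomog_partitionE (leqnn (mmeasure mf r))).
    elim/big_ind: _ => [|u v uP vP|d _] //.
    by rewrite -[u]mul1r; apply: PD.
  by rewrite negb_forall => /existsP[d dP]; exists d.
have [a aP] := comp degX p pP.
by have [b bP] := comp degY _ aP; exists a, b.
Qed.

End BihomogeneousPrime.

(** The chart where [X_i] and [Y_j] are nonzero. Its coordinate ring is [{poly
    {poly k}}], with inner variable [X_i' / X_i] and outer variable [Y_j' /
    Y_j]. The fraction field enters only through an embedding [phi] into an
    arbitrary field. *)
Section Chart.
Variables (k F : fieldType) (phi : {rmorphism {mpoly k[2 + 2]} -> F})
  (i j : 'I_2).
Hypothesis phi_inj : injective phi.

Local Notation R4 := {mpoly k[2 + 2]}.

Definition dehomogenize : {mpoly k[2 + 2]} -> {poly {poly k}} :=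
  mmap (polyC \o polyC)
    (fun l => match split l with
              | inl l => if l == i then 1 else 'X%:P
              | inr l => if l == j then 1 else 'X end).
HB.instance Definition _ := GRing.RMorphism.on dehomogenize.

Let ratX : F := (phi (varX k (rev_ord i)) / phi (varX k i)).
Let ratY : F := (phi (varY k (rev_ord j)) / phi (varY k j)).
Let ratC : {rmorphism k -> F} := phi \o @mpolyC (2 + 2) k.
Let horner_ratX := horner_morph (fun a => mulrC ratX (ratC a)).

Definition chart : {poly {poly k}} -> F :=
  horner_morph (fun a => mulrC ratY (horner_ratX a)).
HB.instance Definition _ := GRing.RMorphism.on chart.

Lemma chartC c : chart c%:P%:P = phi c%:MP.
Proof. by rewrite /chart horner_morphC /= /horner_ratX horner_morphC. Qed.

Lemma chartX : chart 'X%:P = phi (varX k (rev_ord i)) / phi (varX k i).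
Proof. by rewrite /chart horner_morphC /= /horner_ratX horner_morphX. Qed.

Lemma chartY : chart 'X = phi (varY k (rev_ord j)) / phi (varY k j).
Proof. by rewrite /chart horner_morphX. Qed.

Lemma ord2_rev (a b : 'I_2) : a != b -> a = rev_ord b.
Proof. by have [->|->] := ord2P a; have [->|->] := ord2P b => // _;
  apply: val_inj. Qed.

Let X_neq0 : phi (varX k i) != 0.
Proof. by rewrite -(rmorph0 phi) (inj_eq phi_inj) -msupp_eq0 msuppX. Qed.

Let Y_neq0 : phi (varY k j) != 0.
Proof. by rewrite -(rmorph0 phi) (inj_eq phi_inj) -msupp_eq0 msuppX. Qed.

Lemma chart_dehomogenize (a b : nat) (p : R4) : bihomog a b p ->
  phi p = phi (varX k i ^+ a * varY k j ^+ b) * chart (dehomogenize p).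
Proof.
move=> p_ab; rewrite [in RHS]/dehomogenize rmorph_mmap rmorphM !rmorphXn.
rewrite [LHS](mpoly_mmap_id phi).
rewrite -(mmap_scale_bihomog (chart \o (polyC \o polyC))
  (w := fun l => phi 'X_l) p_ab) => [|l|l].
- by apply: eq_bigr => m _; rewrite /= chartC.
- rewrite /= (unsplitK (inl l)); case: eqVneq => [->|/ord2_rev->].
    by rewrite rmorph1 mulr1.
  by rewrite chartX mulrC divfK.
- rewrite /= (unsplitK (inr l)); case: eqVneq => [->|/ord2_rev->].
    by rewrite rmorph1 mulr1.
  by rewrite chartY mulrC divfK.
Qed.

Section ChartPrime.
Variable P : {pred R4}.
Hypotheses (P_ideal : idealr_closed P) (P_prime : prime_idealr_closed P).
Hypotheses (XP : varX k i \notin P) (YP : varY k j \notin P).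

Let ideal0 : 0 \in P. Proof. by case: P_ideal. Qed.
Let ideal1 : 1 \notin P. Proof. by case: P_ideal. Qed.
Let idealM a u : u \in P -> a * u \in P.
Proof. by case: P_ideal => P0 _ PD uP; rewrite -[a * u]addr0; apply: PD. Qed.
Let idealD u v : u \in P -> v \in P -> u + v \in P.
Proof. by case: P_ideal => P0 _ PD uP vP; rewrite -[u]mul1r; apply: PD. Qed.
Let notinM u v : u \notin P -> v \notin P -> u * v \notin P.
Proof.
by move=> uP vP; apply/negP => /P_prime; rewrite (negPf uP) (negPf vP).
Qed.
Let notinX u n : u \notin P -> u ^+ n \notin P.
Proof.
move=> uP; elim: n => [|n IH]; first by rewrite ideal1.
by rewrite exprS notinM.
Qed.

(** The prime of the chart defined by [P]: contraction of the extension of [P]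
    to its localization. Any denominator outside [P] is accepted, which makes
    primality straightforward. *)
Definition chart_prime (u : {poly {poly k}}) : Prop :=
  exists2 s, s \notin P & exists2 p, p \in P & phi s * chart u = phi p.

Lemma chart_denominator u : exists2 s, s \notin P & exists p, phi s * chart u =
    phi p.
Proof.
elim/poly2_ring_ind: u => [c| | |u v|u v].
- by exists 1 => //; exists c%:MP; rewrite rmorph1 mul1r chartC.
- exists (varX k i) => //; exists (varX k (rev_ord i)).
  by rewrite chartX mulrC divfK.
- exists (varY k j) => //; exists (varY k (rev_ord j)).
  by rewrite chartY mulrC divfK.
- move=> [s sP [p su]] [t tP [r tv]]; exists (s * t); first exact: notinM.
  exists (t * p + s * r);
    rewrite [chart _]rmorphD [phi (_ + _)]rmorphD !rmorphM -su -tv; ring.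
- move=> [s sP [p su]] [t tP [r tv]]; exists (s * t); first exact: notinM.
  exists (p * r); rewrite !rmorphM -su -tv; ring.
Qed.

Lemma chart_prime_ideal : prime_ideal chart_prime.
Proof.
split.
- by exists 1 => //; exists 0; rewrite // rmorph0 mulr0 rmorph0.
- move=> [s sP [p pP]]; rewrite rmorph1 mulr1 => /phi_inj sp.
  by rewrite sp pP in sP.
- move=> u v [s sP [p pP su]] [t tP [r rP tv]]; exists (s * t);
  first exact: notinM.
  exists (t * p + s * r); first by rewrite idealD ?idealM.
  rewrite [chart _]rmorphD [phi (_ + _)]rmorphD !rmorphM -su -tv; ring.
- move=> u v [t tP [r rP tv]]; have [s sP [p su]] := chart_denominator u.
  exists (s * t); first exact: notinM.
  exists (p * r); first exact: idealM.
  rewrite !rmorphM -su -tv; ring.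
- move=> u v [w wP [z zP wuv]].
  have [s sP [p su]] := chart_denominator u;
    have [t tP [r tv]] := chart_denominator v.
  have wpr : w * (p * r) \in P.
    have -> : w * (p * r) = (s * t) * z; last exact: idealM.
    apply: phi_inj.
    rewrite [chart (u * v)]rmorphM in wuv.
    by rewrite !(rmorphM phi) -wuv -su -tv; ring.
  have := P_prime wpr; rewrite (negPf wP) /= => /P_prime/orP[pP|rP].
    by left; exists s => //; exists p.
  by right; exists t => //; exists r.
Qed.

Lemma chart_prime_dehomogenize (a b : nat) (p : R4) : bihomog a b p ->
  chart_prime (dehomogenize p) <-> p \in P.
Proof.
move=> p_ab; have pE := chart_dehomogenize p_ab;
  set m := varX k i ^+ a * varY k j ^+ b in pE.
have mP : m \notin P by rewrite notinM ?notinX.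
split=> [[s sP [r rP sp]]|pP]; last by exists m => //; exists p.
have : s * p \in P.
  have -> : s * p = m * r; last exact: idealM.
  apply: phi_inj.
  by rewrite [in RHS]rmorphM -sp rmorphM pE mulrCA.
by move/P_prime; rewrite (negPf sP).
Qed.

End ChartPrime.

(** A denominator outside [P] may lie in [P'], but [u] also has a denominator
    outside [P'], and membership in [P] does not depend on the choice. *)
Lemma chart_prime_sub (P P' : {pred {mpoly k[2 + 2]}}) u :
    idealr_closed P -> prime_idealr_closed P ->
    idealr_closed P' -> prime_idealr_closed P' ->
    varX k i \notin P' -> varY k j \notin P' ->
    {subset P <= P'} -> chart_prime P u -> chart_prime P' u.
Proof.
move=> P_ideal P_prime P'_ideal P'_prime XP' YP' PP' [s sP [p pP su]].
have [t tP' [r tu]] := chart_denominator P'_ideal P'_prime XP' YP' u.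
exists t => //; exists r => //; apply: PP'.
have : s * r \in P.
  have -> : s * r = t * p + 0.
    by rewrite addr0; apply: phi_inj; rewrite !(rmorphM phi) -su -tu mulrCA.
  by case: P_ideal => P0 _; apply.
by move/P_prime; rewrite (negPf sP).
Qed.

End Chart.

(** A chain of three points lies in a single chart, where it gives a strict
    chain of three nonzero primes of the affine plane. Nonvanishing and
    strictness are transferred through bihomogeneous components. *)
Lemma scheme_chain_bound_in (k : finFieldType) (K : fieldType)
    (phi : {rmorphism {mpoly k[2 + 2]} -> K}) (F : {mpoly k[2 + 2]}) (m : nat)
    (P : 'I_m.+1 -> {pred {mpoly k[2 + 2]}}) :
  injective phi -> F != 0 -> scheme_chain F P -> (m <= 1)%N.
Proof.
move=> phi_inj F_neq0 [P_point P_chain]; rewrite leqNgt; apply/negP => m_gt1.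
pose o0 : 'I_m.+1 := ord0.
pose o1 : 'I_m.+1 := Ordinal (ltnW m_gt1 : 1 < m.+1)%N.
pose o2 : 'I_m.+1 := Ordinal (m_gt1 : 2 < m.+1)%N.
have [P01 [w wP1 wP0]] := P_chain o0 o1 isT.
have [P12 [z zP2 zP1]] := P_chain o1 o2 isT.
have [[P2_ideal P2_comp] P2_prime _ [i XP2] [j YP2]] := P_point o2.
have [[P1_ideal P1_comp] P1_prime _ _ _] := P_point o1.
have [[P0_ideal P0_comp] P0_prime FP0 _ _] := P_point o0.
have XP1 : varX k i \notin P o1 by apply: contra XP2; apply: P12.
have YP1 : varY k j \notin P o1 by apply: contra YP2; apply: P12.
have XP0 : varX k i \notin P o0 by apply: contra XP1; apply: P01.
have YP0 : varY k j \notin P o0 by apply: contra YP1; apply: P01.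
pose Q l := chart_prime phi i j (P l).
have Q0_prime : prime_ideal (Q o0) by apply: chart_prime_ideal.
have Q1_prime : prime_ideal (Q o1) by apply: chart_prime_ideal.
have Q2_prime : prime_ideal (Q o2) by apply: chart_prime_ideal.
have Q01 u : Q o0 u -> Q o1 u by apply: chart_prime_sub.
have Q12 u : Q o1 u -> Q o2 u by apply: chart_prime_sub.
(* The first prime is nonzero for the reason that makes the inclusions strict,
   with the zero ideal as smaller ideal. *)
have trivial_ideal : idealr_closed (pred1 (0 : {mpoly k[2 + 2]})).
  split=> [||a u v]; rewrite !inE ?oner_eq0 //.
  by move=> /eqP-> /eqP->; rewrite mulr0 addr0.
have [a [b Fab_neq0]] :=
  bihomog_component trivial_ideal (F_neq0 : F \notin pred1 0).
have [c [d wcd_P0]] := bihomog_component P0_ideal wP0.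
have [c' [d' zcd_P1]] := bihomog_component P1_ideal zP1.
have bihomog_comp e e' p := @bihomog_pihomog k e e' p.
have dehom0 e e' p := chart_prime_dehomogenize phi_inj P0_ideal P0_prime XP0 YP0
  (bihomog_comp e e' p).
have dehom1 e e' p := chart_prime_dehomogenize phi_inj P1_ideal P1_prime XP1 YP1
  (bihomog_comp e e' p).
have dehom2 e e' p := chart_prime_dehomogenize phi_inj P2_ideal P2_prime XP2 YP2
  (bihomog_comp e e' p).
have compP l p e e' : bihomogeneous_ideal (P l) -> p \in P l ->
    pihomog degY e' (pihomog degX e p) \in P l.
  by case=> _ P_comp /(P_comp e)[/(P_comp e')[]].
have Fab_P0 := compP o0 F a b (conj P0_ideal P0_comp) FP0.
have wcd_P1 := compP o1 w c d (conj P1_ideal P1_comp) wP1.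
have zcd_P2 := compP o2 z c' d' (conj P2_ideal P2_comp) zP2.
case/negP: zcd_P1; apply/dehom1.
apply: (affine_plane_no_chain Q0_prime Q1_prime Q2_prime Q01 Q12
  (h := dehomogenize i j (pihomog degY b (pihomog degX a F)))
  (w := dehomogenize i j (pihomog degY d (pihomog degX c w)))).
- by apply/dehom0.
- apply: contra Fab_neq0 => /eqP Fab0; rewrite inE.
  rewrite -(inj_eq phi_inj)
    (chart_dehomogenize i j phi_inj (@bihomog_comp a b F)).
  by rewrite Fab0 !rmorph0 mulr0.
- by apply/dehom1.
- by move/dehom0; apply/negP.
- by apply/dehom2.
Qed.

Lemma scheme_chain_bound (k : finFieldType) (F : {mpoly k[2 + 2]}) (m : nat)
    (P : 'I_m.+1 -> {pred {mpoly k[2 + 2]}}) :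
  F != 0 -> scheme_chain F P -> (m <= 1)%N.
Proof.
apply: (@scheme_chain_bound_in k _ (@tofrac {mpoly k[2 + 2]})) => u v /eqP.
by rewrite tofrac_eq => /eqP.
Qed.

(** * Bihomogeneous ideals of formal branches *)

(** Divisibility proper, whereas [dvdp] on [{poly R}] allows for a constant
    factor when [R] is not a field. *)
Definition divides (R : comNzRingType) (d u : R) := exists v, u = v * d.

Section Divides.
Variables (R : comNzRingType) (d : R).

Lemma divides0 : divides d 0.
Proof. by exists 0; rewrite mul0r. Qed.

Lemma dividesMl a u : divides d u -> divides d (a * u).
Proof. by case=> v ->; exists (a * v); rewrite mulrA. Qed.

Lemma dividesMr a u : divides d u -> divides d (u * a).
Proof. by rewrite mulrC; apply: dividesMl. Qed.

Lemma dividesD u v : divides d u -> divides d v -> divides d (u + v).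
Proof. by move=> [a ->] [b ->]; exists (a + b); rewrite mulrDl. Qed.

Lemma dividesN u : divides d u -> divides d (- u).
Proof. by case=> a ->; exists (- a); rewrite mulNr. Qed.

Lemma dividesB u v : divides d u -> divides d v -> divides d (u - v).
Proof. by move=> du dv; apply: dividesD => //; apply: dividesN. Qed.

Lemma divides_mmapB (n : nat) (S : nzRingType) (h : {rmorphism S -> R})
    (v w : 'I_n -> R) (p : {mpoly S[n]}) :
  (forall i, divides d (v i - w i)) -> divides d (mmap h v p - mmap h w p).
Proof.
move=> vw; elim/mpoly_ring_ind: p => [c|i|p r IHp IHr|p r IHp IHr].
- by rewrite !mmapC subrr; apply: divides0.
- by rewrite !mmapX !mmap1U.
- by rewrite !mmapD opprD addrACA; apply: dividesD.
- rewrite !rmorphM /=.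
  have -> : mmap h v p * mmap h v r - mmap h w p * mmap h w r
    = mmap h v p * (mmap h v r - mmap h w r) +
      (mmap h v p - mmap h w p) * mmap h w r.
    by ring.
  by apply: dividesD; [apply: dividesMl | apply: dividesMr].
Qed.

End Divides.

Lemma divides_trans (R : comNzRingType) (a b c : R) :
  divides a b -> divides b c -> divides a c.
Proof. by move=> [u ->] [v ->]; exists (v * u); rewrite mulrA. Qed.

Lemma dividesMM (R : comNzRingType) (a b c d : R) :
  divides a b -> divides c d -> divides (a * c) (b * d).
Proof. by move=> [u ->] [v ->]; exists (u * v); rewrite mulrACA. Qed.

Lemma divides_exp (R : comNzRingType) (d : R) (m n : nat) :
  (m <= n)%N -> divides (d ^+ m) (d ^+ n).
Proof. by move=> mn; exists (d ^+ (n - m)); rewrite -exprD subnK. Qed.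

Lemma divides_rmorph (R S : comNzRingType) (phi : {rmorphism R -> S})
    (d u : R) :
  divides d u -> divides (phi d) (phi u).
Proof. by case=> v ->; exists (phi v); rewrite rmorphM. Qed.

Lemma divides_Xn (R : comNzRingType) (n : nat) (u : {poly R}) :
  divides 'X^n u <-> forall i, (i < n)%N -> u`_i = 0.
Proof.
split=> [[v ->] i lt_in|u0]; first by rewrite coefMXn lt_in.
exists (drop_poly n u); rewrite -{1}[u](poly_take_drop n).
rewrite [take_poly n u](_ : _ = 0) ?add0r //; apply/polyP => i.
by rewrite coef_take_poly coef0; case: ifP => // /u0.
Qed.

(** The order of vanishing at 0 is additive over an integral domain. *)
Lemma divides_Xn_prime (R : idomainType) (a b : nat) (u v : {poly R}) :
    divides 'X^(a + b) (u * v) ->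
  divides 'X^a u \/ divides 'X^b v.
Proof.
have order (w : {poly R}) n : ~ divides 'X^n w ->
    exists m w', [/\ (m < n)%N, w = w' * 'X^m & w'.[0] != 0].
  move=> nw; have [m [w' w'0 wE]] := multiplicity_XsubC w 0.
  rewrite subr0 in wE.
  have w_neq0 : w != 0 by apply: contra_notN nw => /eqP->; apply: divides0.
  exists m, w'; split=> //; last by move: w'0; rewrite w_neq0 /=.
  rewrite ltnNge; apply: contra_notN nw => nm; rewrite wE.
  by apply: dividesMl; apply: divides_exp.
move=> [z uv]; have [|nu] := pselect (divides 'X^a u); first by left.
right; have [//|nv] := pselect (divides 'X^b v).
have [m [u' [ma uE u'0]]] := order _ _ nu;
  have [n [v' [nb vE v'0]]] := order _ _ nv.
have mn_ab : (m + n < a + b)%N := leq_add ma (ltnW nb).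
have : (u' * v').[0] = 0.
  have -> : u' * v' = z * 'X^(a + b - (m + n)); last first.
    by rewrite hornerM hornerXn expr0n subn_eq0 leqNgt mn_ab mulr0.
  apply: (mulIf (x := 'X^(m + n))); first by rewrite monic_neq0 // monicXn.
  rewrite -[RHS]mulrA -exprD subnK 1?ltnW //.
  by rewrite -uv uE vE exprD mulrACA.
by move/eqP; rewrite hornerM mulf_eq0 (negPf u'0) (negPf v'0).
Qed.

(** The pair [(x, 'X)] of polynomials in [t = 'X] is seen as an arc in the chart
    [X_0 = Y_0 = 1]. It is scaled by two independent variables, the inner
    polynomial variables of [A], because the kernel-like ideals built from the
    scaled arc are then automatically bihomogeneous. The variable [t] is
    outermost, so that orders of vanishing along the arc are read on the
    coefficients. *)
Section Branch.
Variable k : fieldType.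
Local Notation A := {poly {poly k}}.

Definition branch_base : k -> {poly A} := polyC \o (polyC \o polyC).
HB.instance Definition _ := GRing.RMorphism.on branch_base.

Definition branch_embed : {poly k} -> {poly A} := map_poly (polyC \o polyC).
HB.instance Definition _ := GRing.RMorphism.on branch_embed.

Definition affine_point (x : {poly k}) (l : 'I_(2 + 2)) : {poly k} :=
  match split l with
  | inl l => if l == 0 then 1 else x
  | inr l => if l == 0 then 1 else 'X end.

Definition scaleX : {poly A} := ('X : A)%:P.
Definition scaleY : {poly A} := ('X%:P : A)%:P.

Definition branch_point (x : {poly k}) (l : 'I_(2 + 2)) : {poly A} :=
  (if split l is inl _ then scaleX else scaleY) * branch_embed
    (affine_point x l).

Definition branch (x : {poly k}) : {mpoly k[2 + 2]} -> {poly A} :=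
  mmap branch_base (branch_point x).
HB.instance Definition _ x := GRing.RMorphism.on (branch x).

Lemma branchZX x c m :
  branch x (c *: 'X_[m]) =
    (c%:P%:P * ('X^(degX m) * ('X^(degY m))%:P))%:P * branch_embed
      (mmap1 (affine_point x) m).
Proof.
rewrite /branch mmapZ mmapX.
have /(mmap_scale_bihomog branch_base (s := scaleX) (t := scaleY)
  (v := branch_embed \o affine_point x) (w := branch_point x)) :
    @bihomog k (degX m) (degY m) 'X_[m].
  by move=> m'; rewrite msuppX inE => /eqP->.
rewrite !mmapX => -> //; last first.
- by move=> l; rewrite /branch_point /= (unsplitK (inr l)).
- by move=> l; rewrite /branch_point /= (unsplitK (inl l)).
rewrite [LHS]mulrA; congr (_ * _).
  by rewrite /scaleX /scaleY !polyCM !polyC_exp !mulrA.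
by rewrite /mmap1 rmorph_prod; apply: eq_bigr => i _; rewrite rmorphXn.
Qed.

Lemma coef_branchZX x c m i a b :
  (branch x (c *: 'X_[m]))`_i`_a`_b =
    if (degX m == a) && (degY m == b) then c *
      (mmap1 (affine_point x) m)`_i else 0.
Proof.
rewrite branchZX coefCM coef_map /= !(coefCM, coefMC, coefXn).
rewrite [a == _]eq_sym; case: eqP => _ /=;
  last by rewrite mul0r coef0 mulr0 mul0r.
rewrite mul1r coefXn [b == _]eq_sym.
by case: eqP => _; rewrite ?mulr1 // mulr0 mul0r.
Qed.

Lemma branch_sum x (p : {mpoly k[2 + 2]}) :
  branch x p = \sum_(m <- msupp p) branch x (p@_m *: 'X_[m]).
Proof. by rewrite {1}[p]mpolyE rmorph_sum. Qed.

(** The powers of the scaling variables record the bidegree, so taking a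
    component of [p] only selects coefficients. *)
Lemma coef_branch_pihomogX x d (p : {mpoly k[2 + 2]}) i a b :
  (branch x (pihomog degX d p))`_i`_a`_b =
    if a == d then (branch x p)`_i`_a`_b else 0.
Proof.
rewrite pihomogE rmorph_sum branch_sum !coef_sum.
case: eqP => [->|/eqP ad].
  rewrite big_mkcond; apply: eq_bigr => m _; case: ifP => // md.
  by rewrite coef_branchZX md.
by apply: big1 => m /eqP md; rewrite coef_branchZX md eq_sym (negPf ad).
Qed.

Lemma coef_branch_pihomogY x d (p : {mpoly k[2 + 2]}) i a b :
  (branch x (pihomog degY d p))`_i`_a`_b =
    if b == d then (branch x p)`_i`_a`_b else 0.
Proof.
rewrite pihomogE rmorph_sum branch_sum !coef_sum.
case: eqP => [->|/eqP bd].
  rewrite big_mkcond; apply: eq_bigr => m _; case: ifP => // md.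
  by rewrite coef_branchZX md andbF.
by apply: big1 => m /eqP md;
  rewrite coef_branchZX md [d == b]eq_sym (negPf bd) andbF.
Qed.

Lemma divides_branch_pihomog x n d (p : {mpoly k[2 + 2]}) :
    divides 'X^n (branch x p) ->
  divides 'X^n (branch x (pihomog degX d p)) /\ divides 'X^n
    (branch x (pihomog degY d p)).
Proof.
move=> /divides_Xn p0; split; apply/divides_Xn => i i_n; apply/polyP => a;
  apply/polyP => b.
  by rewrite coef_branch_pihomogX p0 // !coef0; case: ifP.
by rewrite coef_branch_pihomogY p0 // !coef0; case: ifP.
Qed.

Lemma divides_branchB n (x x' : {poly k}) (p : {mpoly k[2 + 2]}) :
  divides 'X^n (x - x') -> divides 'X^n (branch x p - branch x' p).
Proof.
move=> xx'; apply: divides_mmapB => l; rewrite /branch_point -mulrBr;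
  apply: dividesMl.
have -> : 'X^n = branch_embed 'X^n by rewrite /branch_embed map_polyXn.
rewrite -rmorphB; apply: divides_rmorph; rewrite /affine_point.
by case: (split l) => l'; case: ifP => _; rewrite ?subrr //; apply: divides0.
Qed.

Lemma branch_varX x : branch x (varX k 0) = scaleX.
Proof.
rewrite /branch /varX mmapX mmap1U /branch_point /affine_point
  (unsplitK (inl 0)) eqxx.
by rewrite rmorph1 mulr1.
Qed.

Lemma branch_varY x : branch x (varY k 0) = scaleY.
Proof.
rewrite /branch /varY mmapX mmap1U /branch_point /affine_point
  (unsplitK (inr 0)) eqxx.
by rewrite rmorph1 mulr1.
Qed.

Lemma branch_varY1 x : branch x (varY k 1) = scaleY * 'X.
Proof.
rewrite /branch /varY mmapX mmap1U /branch_point /affine_point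
  (unsplitK (inr 1)) /=.
by rewrite /branch_embed map_polyX.
Qed.

Definition affine_curve (q : nat) (f g : {mpoly k[2]}) (x : {poly k}) :
    {poly k} :=
  form2 polyC f 1 'X * (x - x ^+ q) + form2 polyC g 1 x * ('X - 'X ^+ q).

(** Bihomogeneity of the equation takes the scaling variables out. *)
Lemma branch_curve_eq q (f g : {mpoly k[2]}) x :
    f \is q.+1.-homog -> g \is q.+1.-homog ->
  branch x (curve_eq q f g)
  = scaleX ^+ q.+1 * scaleY ^+ q.+1 * branch_embed (affine_curve q f g x).
Proof.
move=> f_d g_d.
have embed_form r a b : form2 branch_base r (branch_embed a) (branch_embed b)
    = branch_embed (form2 polyC r a b).
  rewrite rmorph_form2; apply: eq_bigr => m _; congr (_ * _).
  by rewrite /= /branch_embed map_polyC.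
rewrite [LHS]mmap_curve_eq /branch_point /affine_point.
rewrite (unsplitK (inl 0)) (unsplitK (inl 1)) (unsplitK (inr 0))
  (unsplitK (inr 1)) /=.
rewrite (form2_scale _ _ _ _ f_d) (form2_scale _ _ _ _ g_d) !embed_form.
pose e : {rmorphism {poly k} -> {poly A}} := branch_embed.
have eE u : branch_embed u = e u by [].
rewrite /affine_curve !eE; move: (form2 _ f _ _) (form2 _ g _ _) => f1 g1.
rewrite (rmorphD e) !(rmorphM e) !(rmorphB e) !(rmorphXn e) (rmorph1 e) !mulr1.
rewrite !exprMn !exprS; move: (e f1) (e g1) (e x) (e 'X) scaleX scaleY => *.
ring.
Qed.

End Branch.

(** * A branch of the curve and the lower bound on the dimension *)

Lemma divides_X (R : comNzRingType) (u : {poly R}) : u`_0 = 0 -> divides 'X u.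
Proof. by move=> u0; rewrite -['X]expr1; apply/divides_Xn => -[|i] // _. Qed.

Lemma divides_subXX (R : comNzRingType) (x y : R) n :
    divides (x - y) (x ^+ n - y ^+ n).
Proof. by rewrite subrXX; apply: dividesMr; exists 1; rewrite mul1r. Qed.

Lemma dividesXr (R : comNzRingType) (d x : R) n : divides d x -> (0 < n)%N ->
    divides d (x ^+ n).
Proof. by case: n => // n dx _; rewrite exprS; apply: dividesMr. Qed.

(** At the rational point [x = y = 0] of the chart [X_0 = Y_0 = 1], the
    [x]-derivative of the equation is [f (1, 0)], which is nonzero: the curve
    has there a formal branch [x = x(t)], [y = t]. Its Taylor polynomials are
    obtained by Newton iteration. *)
Section Newton.
Variables (k : fieldType) (q : nat) (f g : {mpoly k[2]}).
Hypotheses (q_gt1 : (1 < q)%N) (f_d : f \is q.+1.-homog)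
  (g_d : g \is q.+1.-homog).
Let f0 := form2 idfun f 1 0.
Hypothesis f0_neq0 : f0 != 0.

Definition newton (x : {poly k}) : {poly k} :=
    x - f0^-1%:P * affine_curve q f g x.

Let f1 : {poly k} := form2 polyC f 1 'X.
Let g1 (x : {poly k}) : {poly k} := form2 polyC g 1 x.

Lemma newton_slope : divides 'X (1 - f0^-1%:P * f1).
Proof.
apply: divides_X; rewrite coefB coefC coefCM.
have -> : f1`_0 = f0; last by rewrite mulVf // subrr.
rewrite -horner_coef0 -[_.[0]]/(horner_eval 0 _)
  [LHS](rmorph_form2 (horner_eval 0)).
apply: eq_bigr => m _; congr (_ * _); first by rewrite /= /horner_eval hornerC.
apply: eq_bigr => j _; congr (_ ^+ _); rewrite /pair2.
by case: ifP => _ /=; rewrite /horner_eval ?hornerX ?hornerC // rmorph1.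
Qed.

Let divides_XXq : divides 'X ('X - 'X ^+ q : {poly k}).
Proof. by apply: divides_X;
  rewrite coefB coefX coefXn (ltn_eqF (ltnW q_gt1)) subrr. Qed.

Lemma newton_vanish x : divides 'X x -> divides 'X (newton x).
Proof.
move=> Xx; apply: dividesB => //; apply: dividesMl; apply: dividesD.
  apply: dividesMl; apply: dividesB => //.
  by apply: dividesXr => //; apply: ltnW.
exact: dividesMl.
Qed.

(** The slope of [newton] vanishes at the origin, so [newton] is contracting for
    the ['X]-adic distance. *)
Lemma newton_contract x y : divides 'X x -> divides 'X y ->
  divides ('X * (x - y)) (newton x - newton y).
Proof.
move=> Xx Xy; set c := f0^-1%:P.
have -> : newton x - newton y =
  (1 - c * f1) * (x - y) + c * f1 * (x ^+ q - y ^+ q)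
                              - c * (('X - 'X ^+ q) * (g1 x - g1 y)).
  by rewrite /newton /affine_curve -/f1 -/(g1 x) -/(g1 y) -/c; ring.
apply: dividesB; last first.
  apply: dividesMl; apply: dividesMM => //; apply: divides_mmapB => j.
  rewrite /pair2; case: ifP => _; first by rewrite subrr; apply: divides0.
  by exists 1; rewrite mul1r.
apply: dividesD.
  by apply: dividesMM; [exact: newton_slope | exists 1; rewrite mul1r].
apply: dividesMl; case: q q_gt1 => [|[|n]] // _.
have -> : x ^+ n.+2 - y ^+ n.+2 =
  x ^+ n.+1 * (x - y) + y * (x ^+ n.+1 - y ^+ n.+1).
  by rewrite !exprS; ring.
apply: dividesD; apply: dividesMM => //; last exact: divides_subXX.
- exact: dividesXr.
- by exists 1; rewrite mul1r.
Qed.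

Definition newton_iter n : {poly k} := iter n newton 0.

Lemma newton_iter_vanish n : divides 'X (newton_iter n).
Proof. by elim: n => [|n IH]; [exact: divides0 | exact: newton_vanish]. Qed.

Lemma newton_iter_step n : divides 'X^(n.+1) (newton_iter n.+1 - newton_iter n).
Proof.
elim: n => [|n IH]; first by apply: dividesB; apply: newton_iter_vanish.
apply: (divides_trans (b := 'X * (newton_iter n.+1 - newton_iter n)));
  last first.
  exact: newton_contract (newton_iter_vanish n.+1) (newton_iter_vanish n).
by rewrite exprS; apply: dividesMM => //; exists 1; rewrite mul1r.
Qed.

Lemma newton_iter_cauchy n m : (n <= m)%N ->
    divides 'X^n (newton_iter m - newton_iter n).
Proof.
move=> /subnK<-; elim: (m - n)%N => [|e IH]; first by rewrite subrr;
  apply: divides0.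
rewrite addSn -(subrK (newton_iter (e + n)) (newton_iter _)) -addrA.
apply: dividesD => //; apply: (divides_trans _ (newton_iter_step _)).
by apply: divides_exp; rewrite leqW // leq_addl.
Qed.

Lemma newton_iter_root n : divides 'X^n (affine_curve q f g (newton_iter n)).
Proof.
have -> : affine_curve q f g (newton_iter n)
    = - f0%:P * (newton_iter n.+1 - newton_iter n).
  rewrite /newton_iter iterS -/(newton_iter n) /newton addrAC subrr sub0r
    mulrNN.
  by rewrite mulrA -polyCM divff // mul1r.
apply: dividesMl; apply: (divides_trans _ (newton_iter_step _)).
exact: divides_exp.
Qed.

(** For [B] always true, this is the ideal of polynomials vanishing on the whole
    branch, seen through its truncations; for [B] true only at 1, it is the
    ideal of the origin of the branch. *)
Definition branch_ideal (B : nat -> Prop) : {pred {mpoly k[2 + 2]}} :=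
  [pred p | `[< forall n, B n -> divides 'X^n (branch (newton_iter n) p) >]].

Lemma branch_idealP (B : nat -> Prop) p :
  reflect (forall n, B n -> divides 'X^n (branch (newton_iter n) p))
    (p \in branch_ideal B).
Proof. exact: asboolP. Qed.

Lemma branch_ideal_bihomogeneous (B : nat -> Prop) :
  B 1%N -> bihomogeneous_ideal (branch_ideal B).
Proof.
move=> B1; split; first split.
- by apply/branch_idealP => n _; rewrite rmorph0; apply: divides0.
- apply/negP => /branch_idealP/(_ 1%N B1)/divides_Xn/(_ 0%N isT)/eqP.
  by rewrite rmorph1 coef1 /= oner_eq0.
- move=> a u v /branch_idealP uB /branch_idealP vB; apply/branch_idealP => n Bn.
  by rewrite rmorphD rmorphM; apply: dividesD;
    [apply: dividesMl; exact: uB | exact: vB].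
- by move=> d p /branch_idealP pB; split;
  apply/branch_idealP => n /pB/(divides_branch_pihomog d)[].
Qed.

Lemma curve_eq_branch_ideal (B : nat -> Prop) :
    curve_eq q f g \in branch_ideal B.
Proof.
apply/branch_idealP => n _; rewrite branch_curve_eq //; apply: dividesMl.
have -> : 'X^n = branch_embed 'X^n by move=> ?;
  rewrite /branch_embed map_polyXn.
by apply: divides_rmorph; apply: newton_iter_root.
Qed.

Lemma divides_branch_newton n m p : (n <= m)%N ->
  divides 'X^n (branch (newton_iter m) p) ->
    divides 'X^n (branch (newton_iter n) p).
Proof.
move=> nm Xm; rewrite -[branch _ p](subKr (branch (newton_iter m) p)).
by apply: dividesB => //; apply: divides_branchB; apply: newton_iter_cauchy.
Qed.

(** If [u] does not vanish to order [a] along the branch, then the order at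
    least [a + b] of [u * v] forces [v] to vanish to order [b], for every
    [b]. *)
Lemma branch_ideal_prime_all : prime_idealr_closed (branch_ideal (fun=> True)).
Proof.
move=> u v /branch_idealP uv; have [//|uP] := boolP (u \in _).
have [a ua] : exists a, ~ divides 'X^a (branch (newton_iter a) u).
  by apply/existsNP => ub; case/negP: uP; apply/branch_idealP => n _.
apply/branch_idealP => b _; have := uv (a + b)%N I; rewrite rmorphM.
case/divides_Xn_prime => [/divides_branch_newton|/divides_branch_newton];
  last first.
  by apply; rewrite leq_addl.
by move=> ua'; case: ua; apply: ua'; rewrite leq_addr.
Qed.

Lemma branch_ideal_prime1 :
    prime_idealr_closed (branch_ideal (fun n => n = 1%N)).
Proof.
move=> u v /branch_idealP/(_ 1%N erefl);
  rewrite rmorphM => /divides_Xn/(_ 0%N isT)/eqP.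
rewrite coef0M mulf_eq0 => /orP[]/eqP e; apply/orP; [left | right];
by apply/branch_idealP => _ ->; apply/divides_Xn => -[].
Qed.

Lemma branch_ideal_relevant (B : nat -> Prop) : B 1%N ->
  varX k 0 \notin branch_ideal B /\ varY k 0 \notin branch_ideal B.
Proof.
move=> B1; split; apply/negP =>
  /branch_idealP/(_ 1%N B1)/divides_Xn/(_ 0%N isT)/eqP.
  by rewrite branch_varX coefC /= polyX_eq0.
by rewrite branch_varY coefC /= polyC_eq0 polyX_eq0.
Qed.

(** The generic point of the branch specializes to its origin: [Y_1] vanishes at
    the origin but, being [t] up to scaling, not along the branch. *)
Lemma scheme_chain_length1 : exists P : 'I_2 -> {pred {mpoly k[2 + 2]}},
  scheme_chain (curve_eq q f g) P.
Proof.
pose B (i : 'I_2) n := if i == 0 then True else n = 1%N.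
have B1 i : B i 1%N by rewrite /B; case: ifP.
exists (fun i => branch_ideal (B i)); split=> [i|i j].
  have [X0 Y0] := branch_ideal_relevant (B1 i); split; last by exists 0.
  - exact: branch_ideal_bihomogeneous.
  - by have [->|->] := ord2P i;
    [exact: branch_ideal_prime_all | exact: branch_ideal_prime1].
  - exact: curve_eq_branch_ideal.
  - by exists 0.
have [->|->] := ord2P i; have [->|->] := ord2P j => // _; split.
  by move=> p /branch_idealP pB; apply/branch_idealP => n _; apply: pB.
exists (varY k 1).
  by apply/branch_idealP => _ ->; rewrite branch_varY1; apply: dividesMl;
    exists 1; rewrite mul1r.
apply/negP => /branch_idealP/(_ 2%N I)/divides_Xn/(_ 1%N isT)/eqP.
by rewrite branch_varY1 coefMX coefC /= polyC_eq0 polyX_eq0.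
Qed.

End Newton.

(** * The theorem *)

(** Every point of the zero locus of the zero polynomial is singular. *)
Lemma smooth_neq0 (k K : fieldType) (h : {rmorphism k -> K})
    (F : {mpoly k[2 + 2]}) :
  smooth_over h F -> F != 0.
Proof.
move=> F_smooth; apply/eqP => F0; apply: F_smooth.
have one_neq0 : const_mx 1 != 0 :> 'rV[K]_2.
  by apply/eqP => /rowP/(_ 0)/eqP; rewrite !mxE oner_eq0.
exists (const_mx 1), (const_mx 1); rewrite F0 /eval2 rmorph0.
by split=> // [|i]; rewrite ?mderiv0 meval0.
Qed.

Theorem theorem1p1 (q : nat) (k : finFieldType) (kbar : closedFieldType)
    (iota : {rmorphism k -> kbar}) (kbar_alg : integralRange iota)
    (q_odd : odd q) (card_k : #|k| = q)
    (f : {mpoly k[2]}) (f_homog : f \is q.+1.-homog)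
    (f_nopoint : no_rational_point f) :
  exists2 g : {mpoly k[2]}, g \is q.+1.-homog &
    smooth_over iota (curve_eq q f g) /\
    space_filling_curve (curve_eq q f g).
Proof.
move: card_k q_odd f_homog => <- q_odd f_homog.
have [g g_homog F_smooth] := smooth_member iota q_odd f_homog f_nopoint.
exists g => //; split=> //; split; last first.
  move=> x y _ _; rewrite /eval2 /meval mmap_curve_eq !expf_card.
  by rewrite !subrr !mulr0 addr0.
split; last by move=> m P; apply: scheme_chain_bound;
  apply: smooth_neq0 F_smooth.
apply: scheme_chain_length1 => //; first exact: finNzRing_gt1.
rewrite -[X in form2 _ _ X _](rmorph1 idfun)
  -[X in form2 _ _ _ X](rmorph0 idfun).
by apply: (no_rational_zero idfun f_nopoint); rewrite oner_eq0.
Qed.
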